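(* Let $A$ be a complete commutative continuous inverse algebra, $G$ a compact group and $(A,G,\alpha)$ a dynamical system, with fixed point algebra $A^G$. Then each character $\chi:A^G\rightarrow\mathbb{C}$ is continuous and extends to a continuous character $\widetilde{\chi}:A\rightarrow\mathbb{C}$ (i.e. $\widetilde{\chi}|_{A^G}=\chi$).
   Context: All algebras are complex. A unital locally convex algebra is a unital associative algebra that is a (Hausdorff) locally convex topological vector space with continuous multiplication; compact groups are Hausdorff topological groups. A continuous inverse algebra (CIA) is a unital locally convex algebra $A$ whose group of units $A^{\times}$ is open in $A$ and whose inversion map $\iota:A^{\times}\rightarrow A^{\times}$, $a\mapsto a^{-1}$, is continuous at $1_A$. It is called complete if it is complete as a locally convex space. A dynamical system $(A,G,\alpha)$ consists of a unital locally convex algebra $A$, a topological group $G$ and a group homomorphism $\alpha:G\rightarrow\mathrm{Aut}(A)$ (into the group of algebra automorphisms of $A$) which induces a continuous action $G\times A\rightarrow A$, $(g,a)\mapsto\alpha(g).a$. Its fixed point algebra is $A^G:=\{a\in A:\ \alpha(g).a=a\ \text{for all } g\in G\}$, with the subspace topology. A character of an algebra $B$ is a nonzero algebra homomorphism $B\rightarrow\mathbb{C}$ (not assumed continuous). *)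

(* Defs.v *)
From HB Require Import structures.
From mathcomp Require Import all_boot all_order all_algebra.
From mathcomp Require Import complex.
From mathcomp Require Import all_classical all_reals all_analysis.

Set Implicit Arguments.
Unset Strict Implicit.
Unset Printing Implicit Defensive.

Import Order.TTheory GRing.Theory Num.Theory.
Import numFieldNormedType.Exports.

Local Open Scope classical_set_scope.
Local Open Scope ring_scope.

(** [Tvs] does not include separation, hence the second field. *)
HB.mixin Record Tvs_isLocallyConvexAlgebra (K : numFieldType) A
    & Tvs K A & GRing.Algebra K A := {
  alg_mul_continuous : continuous (fun z : A * A => z.1 * z.2) ;
  alg_hausdorff : hausdorff_space A
}.

#[short(type="lcAlgType")]
HB.structure Definition LocallyConvexAlgebra (K : numFieldType) :=
  {A of Tvs K A & GRing.Algebra K A & Tvs_isLocallyConvexAlgebra K A}.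

(** The inversion of MathComp is total (the identity on non-units), so its
    continuity at 1 is stated along the neighbourhoods of 1 in the set of
    units. *)
HB.mixin Record LocallyConvexAlgebra_isContinuousInverse (K : numFieldType) A
    & LocallyConvexAlgebra K A & GRing.UnitAlgebra K A := {
  units_open : open [set a : A | a \is a GRing.unit] ;
  invr_continuous1 :
    (fun a : A => a^-1) @ within [set a : A | a \is a GRing.unit] (nbhs 1)
      --> (1^-1 : A)
}.

#[short(type="ciaType")]
HB.structure Definition ContinuousInverseAlgebra (K : numFieldType) :=
  {A of LocallyConvexAlgebra K A & GRing.UnitAlgebra K A
      & LocallyConvexAlgebra_isContinuousInverse K A}.

#[short(type="comCiaType")]
HB.structure Definition ComContinuousInverseAlgebra (K : numFieldType) :=
  {A of ContinuousInverseAlgebra K A & GRing.ComUnitAlgebra K A}.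

(** Completeness for the uniformity given by the additive group. It does not
    mention [entourage]: [Tvs] only requires the entourages to induce the
    topology, so they need not be the translation-invariant ones. *)
Definition tvs_cauchy (K : numFieldType) (E : tvsType K) (F : set_system E) :=
  (fun z : E * E => z.1 - z.2) @ (F, F) --> (0 : E).

Definition tvs_complete (K : numFieldType) (E : tvsType K) :=
  forall F : set_system E,
    ProperFilter F -> tvs_cauchy F -> exists x : E, F --> x.

HB.mixin Record Group_isTopologicalGroup G & Topological G & Group G := {
  mulg_continuous : continuous (fun z : G * G => (z.1 * z.2)%g) ;
  invg_continuous : continuous (fun g : G => (g^-1)%g)
}.

#[short(type="topologicalGroupType")]
HB.structure Definition TopologicalGroup :=
  {G of Topological G & Group G & Group_isTopologicalGroup G}.

(** [dynamical_system alpha]: the maps [alpha g] are algebra automorphisms,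
    [alpha] is a group homomorphism, and the induced action is continuous. *)
Record dynamical_system (K : numFieldType) (A : lcAlgType K)
    (G : topologicalGroupType) (alpha : G -> {lrmorphism A -> A}) : Prop :=
  DynamicalSystem {
    ds_bijective : forall g, bijective (alpha g) ;
    ds_morphism : forall g h a, alpha (g * h)%g a = alpha g (alpha h a) ;
    ds_continuous : continuous (fun z : G * A => alpha z.1 z.2)
  }.

Section FixedPoints.
Context (K : numFieldType) (A : lcAlgType K) (G : topologicalGroupType).
Implicit Type alpha : G -> {lrmorphism A -> A}.

Definition fixed_points alpha : set A := [set a | forall g, alpha g a = a].

Lemma fixed_points_subalg alpha :
  GRing.subsemialg_closed (fun a : A => a \in fixed_points alpha).
Proof.
split.
- by apply/mem_set => g; rewrite rmorph1.
- split; first by apply/mem_set => g; rewrite rmorph0.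
  by move=> a b /set_mem Ha /set_mem Hb; apply/mem_set => g; rewrite rmorphD /= Ha Hb.
- by move=> k a /set_mem Ha; apply/mem_set => g; rewrite linearZ /= Ha.
- by move=> a b /set_mem Ha /set_mem Hb; apply/mem_set => g; rewrite rmorphM /= Ha Hb.
Qed.

Definition fixed_algebra alpha : Type := set_type (fixed_points alpha).

HB.instance Definition _ alpha :=
  SubChoice.copy (fixed_algebra alpha) (set_type (fixed_points alpha)).
HB.instance Definition _ alpha :=
  GRing.SubChoice_isSubAlgebra.Build K A (fun a => a \in fixed_points alpha)
    (fixed_algebra alpha) (fixed_points_subalg alpha).
HB.instance Definition _ alpha :=
  Topological.copy (fixed_algebra alpha) (set_type (fixed_points alpha)).

End FixedPoints.

(** A nonzero multiplicative linear functional, with no continuity required. *)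
Record character (K : numFieldType) (B : algType K) (chi : B -> K^o) : Prop :=
  Character {
    character_linear : linear chi ;
    character_mul : forall a b, chi (a * b) = chi a * chi b ;
    character_neq0 : exists b, chi b != 0
  }.

(* Main.v *)
(** Let [P] be the invariant mean [A -> A^G].  It is [A^G]-linear and fixes [1], so
    the kernel of a character [chi] of [A^G] generates a proper ideal of [A]:
    [1 = sum a_k b_k] with [b_k] in the kernel would give
    [chi 1 = sum chi (P a_k) chi b_k = 0].  The residue field of a maximal ideal
    above it is [C] by Gelfand-Mazur, which yields the extension.  Characters are
    continuous because [1 - u] is a unit for small [u].

    The mean is built without Haar measure: averaging over finitely many
    translates that cover [G] contracts the oscillation of an orbit map, and left
    averages against right averages make the resulting filter Cauchy.

    Gelfand-Mazur is proved without duality: if no [1 - z a] vanishes in the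
    residue field, then with [n = 2^k] the average of [(1 - w t a)^-1] over the
    [n]-th roots of unity [w] is [(1 - t^n a^n)^-1]; its total variation in [t]
    tends to [0] as [k] grows, although it is close to [1] for small [t] and
    close to [0] for large [t]. *)

Require Import Defs.
From HB Require Import structures.
From mathcomp Require Import all_boot all_order all_algebra.
From mathcomp Require Import complex.
From mathcomp Require Import all_classical all_reals all_analysis.
From mathcomp Require Import ring_quotient generic_quotient ring lra.

Set Implicit Arguments.
Unset Strict Implicit.
Unset Printing Implicit Defensive.

Import Order.TTheory GRing.Theory Num.Theory.
Import numFieldNormedType.Exports.

Local Open Scope classical_set_scope.
Local Open Scope ring_scope.

(** * Residue fields *)

Definition proper_ideal_set (A : comNzRingType) (I : set A) :=
  [/\ forall x y, I x -> I y -> I (x + y),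
      forall a x, I x -> I (a * x) & ~ I 1].

(** Zorn's lemma is applied to the sets whose union with [I] is a proper ideal, so that the empty
    chain is admissible. Maximality is delivered as invertibility modulo [M], the form that a
    residue field needs. *)
Lemma maximal_ideal_exists (A : comNzRingType) (I : set A) :
  proper_ideal_set I -> I 0 ->
  exists M : set A, [/\ proper_ideal_set M, I `<=` M &
    forall x, ~ M x -> exists a, M (1 - a * x)].
Proof.
move=> Iideal I0.
have [F FP Ftot|M [Mideal Mmax]] :=
    @Zorn_bigcup A (fun X => proper_ideal_set (X `|` I)).
  have [->|] := eqVneq F set0.
    by rewrite bigcup_set0 set0U.
  move=> /set0P[X0 FX0].
  have lift x : (\bigcup_(X in F) X `|` I) x -> exists2 X, F X & (X `|` I) x.
    by move=> [[X FX Xx]|Ix]; [exists X => //; left|exists X0 => //; right].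
  have sub X : F X -> X `|` I `<=` \bigcup_(X in F) X `|` I.
    by move=> FX; apply: setSU; exact: bigcup_sup.
  split=> [x y /lift[X FX Xx] /lift[Y FY Yy]|a x /lift[X FX Xx]|/lift[X FX]].
  - have [XY|YX] := Ftot _ _ FX FY.
      apply: (sub _ FY); have [YD _ _] := FP _ FY.
      by apply: YD => //; exact: (setSU XY).
    apply: (sub _ FX); have [XD _ _] := FP _ FX.
    by apply: XD => //; exact: (setSU YX).
  - by apply: (sub _ FX); have [_ XM _] := FP _ FX; exact: XM.
  - by have [_ _] := FP _ FX.
exists (M `|` I); split=> // x Mx.
have [MD MM M1] := Mideal; have M0 : (M `|` I) 0 by right.
(* [N] is the ideal generated by the maximal one and [x]; it is strictly larger, hence contains
   [1]. *)
pose N := [set y | exists a m, (M `|` I) m /\ y = m + a * x].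
have MN : M `|` I `<=` N by move=> m Mm; exists 0, m; rewrite mul0r addr0.
have NI : N `|` I = N by apply/setUidl => y Iy; apply: MN; right.
have Nx : N x by exists 1, 0; rewrite mul1r add0r.
have : ~ proper_ideal_set (N `|` I).
  apply: Mmax; split; first by move=> m Mm; apply: MN; left.
  by move=> /(_ _ Nx) Mx'; apply: Mx; left.
rewrite NI => Nproper.
have [a [m [Mm e]]] : N 1; last by exists a; rewrite e addrK.
apply: contrapT => N1; apply: Nproper; split=> //.
  move=> _ _ [a [m [Mm ->]]] [b [n [Mn ->]]].
  exists (a + b), (m + n); rewrite mulrDl addrACA; split=> //; exact: MD.
move=> b _ [a [m [Mm ->]]].
exists (b * a), (b * m); rewrite mulrDr mulrA; split=> //; exact: MM.
Qed.

Section ResidueField.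
Local Open Scope quotient_scope.

Lemma residue_field (A : comNzRingType) (I : set A) :
  proper_ideal_set I -> I 0 ->
  exists (F : fieldType) (p : {rmorphism A -> F}),
    (forall y, exists x, p x = y) /\ (forall x, I x -> p x = 0).
Proof.
move=> Iideal I0; have [M [[MD MM M1] IM Mmax]] := maximal_ideal_exists Iideal I0.
have M_closed : idealr_closed (fun x => x \in M).
  split; first by apply/mem_set/IM.
    by apply/negP => /set_mem.
  by move=> a x y /set_mem Mx /set_mem My; apply/mem_set/MD => //; exact: MM.
pose J : idealr A := HB.pack (fun x : A => x \in M) (isIdealr.Build _ _ M_closed).
pose Q := {ideal_quot J}.
pose p : {rmorphism A -> Q} := \pi_Q.
have pE x y : (p x == p y) = (x - y \in J) by rewrite Quotient.idealrBE.
have p_surj y : exists x, p x = y by exists (repr y); rewrite /p /= reprK.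
have inv_ex (y : Q) : exists z, y != 0 -> z * y = 1.
  have [x <-] := p_surj y; have [Mx|Mx] := pselect (M x).
    by exists 0; rewrite -(rmorph0 p) pE subr0 [x \in _]mem_set.
  have [a Ma] := Mmax x Mx; exists (p a) => _.
  by rewrite -rmorphM -(rmorph1 p); apply/esym/eqP; rewrite pE; exact: mem_set.
have [inv invP] := choice inv_ex.
(* The chosen inverse is unconstrained at [0], where the field structure demands the value [0]. *)
pose inv0 y := if y == 0 then 0 else inv y.
have inv0P (y : Q) : y != 0 -> inv0 y * y = 1.
  by move=> yN0; rewrite /inv0 (negPf yN0) invP.
have inv00 : inv0 0 = 0 by rewrite /inv0 eqxx.
pose F : fieldType := HB.pack Q (GRing.ComNzRing_isField.Build Q inv0P inv00).
exists F, p; split=> // x Ix.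
by apply/eqP; rewrite -[0](rmorph0 p) pE subr0; exact/mem_set/IM.
Qed.

End ResidueField.
(** * Absolutely convex neighbourhoods and finite averages *)

Section AbsolutelyConvex.
Context (K : numFieldType) (E : tvsType K).
Implicit Types (U V C : set E) (x y : E).

Definition is_convex C := forall x y (t : K),
  C x -> C y -> 0 <= t -> t <= 1 -> C (t *: x + (1 - t) *: y).

(** Absolutely convex neighbourhoods of [0]: the condition on [a] and [b] unites convexity with
    stability under scalars of modulus at most 1. *)
Definition disk U := nbhs 0 U /\
  forall x y (a b : K), U x -> U y -> `|a| + `|b| <= 1 -> U (a *: x + b *: y).

(** Membership in the dilate [r U] stands for a bound by [r] on the gauge of [U] at [x]. *)
Definition scaled U (r : K) x := exists2 u, U u & x = r *: u.

Lemma disk0 U : disk U -> U 0.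
Proof. by move=> [/nbhs_singleton]. Qed.

Lemma diskZ U (a : K) x : disk U -> `|a| <= 1 -> U x -> U (a *: x).
Proof.
move=> Ud a1 Ux; have [_ /(_ x x a 0 Ux Ux)] := Ud.
by rewrite normr0 addr0 scale0r addr0; exact.
Qed.

Lemma diskN U x : disk U -> U x -> U (- x).
Proof. by move=> Ud Ux; rewrite -scaleN1r; apply: diskZ; rewrite // normrN normr1. Qed.

Lemma disk_convex U : disk U -> is_convex U.
Proof.
move=> [_ Ud] x y t Ux Uy t0 t1; apply: Ud => //.
by rewrite ger0_norm// ger0_norm ?subr_ge0// addrC subrK.
Qed.

Lemma diskI U V : disk U -> disk V -> disk (U `&` V).
Proof.
move=> [U0 UD] [V0 VD]; split; first exact: filterI.
by move=> x y a b [Ux Vx] [Uy Vy] ab; split; [exact: UD|exact: VD].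
Qed.

Lemma convex_nbhs0 V : nbhs 0 V -> exists C, [/\ nbhs 0 C, is_convex C & C `<=` V].
Proof.
move=> V0; have [B Bconvex [Bopen Bbasis]] := @locally_convex K E.
have [C [BC C0] CV] := Bbasis 0 V V0.
exists C; split=> //; first exact: open_nbhs_nbhs (conj (Bopen _ BC) C0).
move=> x y t Cx Cy t0 t1.
have := Bconvex C (mem_set BC) x y (Itv01 t0 t1) (mem_set Cx) (mem_set Cy).
by move=> /set_mem.
Qed.

(** The balanced core of a convex neighbourhood is absolutely convex, and continuity of scalar
    multiplication at [(0, 0)] makes it a neighbourhood. *)
Lemma disk_basis V : nbhs 0 V -> exists2 U, disk U & U `<=` V.
Proof.
move=> /convex_nbhs0[C [C0 Cconvex CV]].
pose U := [set x | forall a : K, `|a| <= 1 -> C (a *: x)].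
have UC : U `<=` C by move=> x /(_ 1); rewrite normr1 scale1r; exact.
have C00 : C 0 by exact: nbhs_singleton C0.
exists U; last exact: subset_trans CV.
split; last first.
  (* The phase of [z] is absorbed into the vector, so that only nonnegative coefficients remain and
     convexity of [C] applies. *)
  have rot x (z : K) : U x -> exists2 X, C X & z *: x = `|z| *: X.
    move=> Ux; have [->|z0] := eqVneq z 0.
      by exists 0; rewrite // normr0 scaler0 scale0r.
    exists ((z / `|z|) *: x); last by rewrite scalerA mulrCA divff ?mulr1 ?normr_eq0.
    by apply: Ux; rewrite normrM normfV normr_id divff ?normr_eq0.
  move=> x y a b Ux Uy ab c c1.
  rewrite scalerDr !scalerA.
  have [X CX ->] := rot x (c * a) Ux; have [Y CY ->] := rot y (c * b) Uy.
  set p : K := `|c * a|; set q : K := `|c * b|.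
  have p0 : 0 <= p := normr_ge0 _.
  have q0 : 0 <= q := normr_ge0 _.
  have pq1 : p + q <= 1.
    by rewrite /p /q !normrM -mulrDr mulr_ile1// addr_ge0.
  have [s0|s0] := eqVneq (p + q) 0.
    have /andP[/eqP -> /eqP ->] : (p == 0) && (q == 0) by rewrite -paddr_eq0 ?s0.
    by rewrite !scale0r addr0.
  have s_ge0 : 0 <= p + q by rewrite addr_ge0.
  (* Convexity is used twice: to combine [X] and [Y] with weights of sum 1, then to shrink by
     [p + q] towards [0]. *)
  have -> : p *: X + q *: Y = (p + q) *: ((p / (p + q)) *: X + (1 - p / (p + q)) *: Y)
      + (1 - (p + q)) *: 0.
    rewrite scaler0 addr0 scalerDr !scalerA mulrBr mulr1 mulrCA divff// mulr1.
    by rewrite [p + q]addrC addrK.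
  apply: (Cconvex) => //; apply: (Cconvex) => //.
    by rewrite divr_ge0.
  have s_gt0 : 0 < p + q by rewrite lt_neqAle eq_sym s0.
  by rewrite ler_pdivrMr// mul1r lerDl.
have := @scale_continuous K E (0, 0) C; rewrite /= scaler0 => /(_ C0).
move=> [[A B] /= [/nbhs_ballP[d /= d0 dA] B0] AB].
have d20 : d / 2 != 0 by rewrite mulf_neq0 ?gt_eqF// invr_neq0.
apply: filterS (nbhs0Z d20 B0) => _ [x Bx <-] a a1.
rewrite scalerA; apply: (AB (a * (d / 2), x)); split=> //=; apply: dA.
rewrite -ball_normE /= sub0r normrN normrM (gtr0_norm (divr_gt0 d0 _))//.
apply: (@le_lt_trans _ _ (1 * (d / 2))); first by rewrite ler_wpM2r // divr_ge0 // ltW.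
by rewrite mul1r ltr_pdivrMr// ltr_pMr// ltr1n.
Qed.

Lemma small_multiples V x : nbhs 0 V ->
  exists2 d : K, 0 < d & forall a, `|a| < d -> V (a *: x).
Proof.
move=> V0; have := @scale_continuous K E (0, x) V; rewrite /= scale0r => /(_ V0).
move=> [[A B] /= [/nbhs_ballP[d /= d0 dA] Bx] AB].
exists d => // a ad; apply: (AB (a, x)); split=> /=; last exact: nbhs_singleton Bx.
by apply: dA; rewrite -ball_normE /= sub0r normrN.
Qed.

Lemma addr_left_continuous x : continuous (fun y : E => x + y).
Proof.
move=> y; apply: (@continuous_comp _ (E * E)%type _ (fun y => (x, y))
  (fun z => z.1 + z.2)); last exact: add_continuous.
by apply: cvg_pair; [exact: cvg_cst|exact: cvg_id].
Qed.

Lemma scaled_add U (r s : K) x y : disk U -> 0 <= r -> 0 <= s ->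
  scaled U r x -> scaled U s y -> scaled U (r + s) (x + y).
Proof.
move=> Ud r0 s0 [u Uu ->] [v Uv ->].
have [rs0|rs0] := eqVneq (r + s) 0.
  have /andP[/eqP -> /eqP ->] : (r == 0) && (s == 0) by rewrite -paddr_eq0 ?rs0.
  by exists 0; [exact: disk0|rewrite !addr0 !scale0r addr0].
exists ((r / (r + s)) *: u + (s / (r + s)) *: v).
  apply: (Ud.2) => //; rewrite !ger0_norm ?divr_ge0 ?addr_ge0//.
  by rewrite -mulrDl divff.
by rewrite scalerDr !scalerA ![(r + s) * _]mulrCA !divff// !mulr1.
Qed.

Lemma scaled_scale U (r s a : K) x : disk U -> `|a| <= s ->
  scaled U r x -> scaled U (s * r) (a *: x).
Proof.
move=> Ud as_ [u Uu ->]; have [s0|s0] := eqVneq s 0.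
  exists 0; first exact: disk0.
  by move: as_; rewrite s0 normr_le0 => /eqP ->; rewrite mul0r !scale0r.
exists ((a / s) *: u); last by rewrite !scalerA mulrAC mulrCA divff ?mulr1 // mulrC.
apply: diskZ => //; have sge0 : 0 <= s by exact: le_trans as_.
by rewrite normrM normfV (ger0_norm sge0) ler_pdivrMr ?mul1r// lt_neqAle eq_sym s0.
Qed.

Lemma scaled1 U x : scaled U 1 x <-> U x.
Proof.
split=> [[u Uu ->]|Ux]; first by rewrite scale1r.
by exists x; rewrite ?scale1r.
Qed.

Lemma scaled_le U (r s : K) x : disk U -> 0 <= r -> r <= s -> scaled U r x -> scaled U s x.
Proof.
move=> Ud r0 rs Ux; rewrite -[x]addr0 -(subrK r s) [_ + r]addrC.
apply: scaled_add => //; first by rewrite subr_ge0.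
by exists 0; [exact: disk0|rewrite scaler0].
Qed.

Lemma scaled0 U r : disk U -> scaled U r 0.
Proof. by move=> Ud; exists 0; [exact: disk0|rewrite scaler0]. Qed.

Lemma scaledN U r x : disk U -> scaled U r x -> scaled U r (- x).
Proof. by move=> Ud [u Uu ->]; exists (- u); [exact: diskN|rewrite scalerN]. Qed.

Lemma scaled_convex U r : disk U -> is_convex (scaled U r).
Proof.
move=> Ud _ _ t [u Uu ->] [v Uv ->] t0 t1; exists (t *: u + (1 - t) *: v).
  exact: disk_convex.
by rewrite scalerDr !scalerA ![r * _]mulrC.
Qed.

End AbsolutelyConvex.

Section Averages.
Context (R : realType) (E : tvsType R[i]).
Implicit Types (U V C : set E) (x y : E).

Lemma complex_nat_lt (d : R[i]) : 0 < d -> exists n : nat, n.+1%:R^-1 < d.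
Proof.
move=> d0; have /complex_realP[r dE] : d \is Num.real by exact: gtr0_real.
rewrite dE ltcR in d0 *; exists (Num.truncn r^-1).
rewrite -(rmorph_nat (real_complex R)) -fmorphV ltcR invf_plt ?posrE//.
exact: truncnS_gt.
Qed.

(** One dilate absorbs a whole neighbourhood of [x]; over a compact set such local bounds become a
    uniform one. *)
Lemma scaled_near U x : disk U ->
  exists n : nat, \forall y \near x, scaled U n.+1%:R y.
Proof.
move=> [U0 _]; have := @scale_continuous R[i] E (0, x) U; rewrite /= scale0r.
move=> /(_ U0)[[A B] /= [/nbhs_ballP[d /= d0 dA] Bx] AB].
have [n nd] := complex_nat_lt d0; exists n; apply: filterS Bx => y By.
exists (n.+1%:R^-1 *: y); last by rewrite scalerA divff ?scale1r// pnatr_eq0.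
apply: (AB (n.+1%:R^-1, y)); split=> //=; apply: dA.
by rewrite -ball_normE /= sub0r normrN ger0_norm// invr_ge0 ler0n.
Qed.

Definition average (T : Type) (l : seq T) (F : T -> E) : E :=
  (size l)%:R^-1 *: \sum_(t <- l) F t.

Lemma convex_average (T : Type) (l : seq T) (F : T -> E) C : is_convex C ->
  (0 < size l)%N -> (forall t, C (F t)) -> C (average l F).
Proof.
move=> Cc l0 CF; case: l l0 => // t l _; elim: l t => [|t' l IH] t.
  by rewrite /average big_seq1 invr1 scale1r.
rewrite /average big_cons; set n := size (t' :: l).
have n0 : n%:R != 0 :> R[i] by rewrite pnatr_eq0.
have nS0 : n.+1%:R != 0 :> R[i] by rewrite pnatr_eq0.
have -> : (size (t :: t' :: l))%:R^-1 *: (F t + \sum_(j <- t' :: l) F j) =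
    n.+1%:R^-1 *: F t + (1 - n.+1%:R^-1) *: average (t' :: l) F.
  rewrite /average scalerDr -/n; congr (_ + _); rewrite scalerA; congr (_ *: _).
  by rewrite -natr1 in nS0 *; field; rewrite n0.
apply: Cc => //.
by rewrite invf_le1 ?ler1n// ltr0n.
Qed.

Lemma average_sub (T : Type) (l : seq T) (F F' : T -> E) :
  average l F - average l F' = average l (fun t => F t - F' t).
Proof. by rewrite /average -scalerBr sumrB. Qed.

(* Reordering the two sums so that [F s] is paired with [F' t] lowers the bound:
   only the other [size l - 1] pairs can differ by the full oscillation. *)
Lemma average_contraction (T : choiceType) (l : seq T) (F F' : T -> E) U (s t : T)
    (j : nat) : disk U -> s \in l -> t \in l ->
  (forall h h', scaled U (j.+1%:R / (2 * size l)%:R) (F h - F' h')) ->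
  ((2 * size l)%N <= j)%N ->
  scaled U 2^-1 (F s - F' t) ->
  scaled U (j%:R / (2 * size l)%:R) (average l F - average l F').
Proof.
move=> Ud sl tl osc jl Fst.
have l0 : (0 < size l)%N by case: (l) sl.
set n := size l in l0 jl osc *; set d := _ / _ in osc.
have n0 : n%:R != 0 :> R[i] by rewrite pnatr_eq0 -lt0n.
have d0 : 0 <= d by rewrite divr_ge0.
rewrite /average -scalerBr.
rewrite (perm_big _ (perm_to_rem sl)) (perm_big _ (perm_to_rem tl)) !big_cons.
rewrite opprD addrACA.
have rest l1 l2 : size l1 = size l2 ->
    scaled U ((size l1)%:R * d) (\sum_(h <- l1) F h - \sum_(h <- l2) F' h).
  elim: l1 l2 => [|h l1 IH] [|h' l2] //= => [_|[e]].
    by rewrite !big_nil subrr mul0r; exact: scaled0.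
  rewrite !big_cons opprD addrACA -natr1 mulrDl mul1r addrC.
  by apply: scaled_add => //; rewrite ?mulr_ge0//; exact: IH.
have eqr : size (rem s l) = size (rem t l) by rewrite !size_rem.
have := scaled_add Ud _ _ Fst (rest _ _ eqr).
rewrite invr_ge0 ler0n mulr_ge0// size_rem// -/n => /(_ isT isT) sumU.
have := @scaled_scale _ _ U _ n%:R^-1 n%:R^-1 _ Ud _ sumU.
rewrite ger0_norm ?invr_ge0// lexx => /(_ isT); apply: scaled_le => //.
  by rewrite mulr_ge0 ?invr_ge0 ?addr_ge0 ?mulr_ge0 ?invr_ge0.
(* The slack is nonnegative as [2 * n <= j]; so averaging lowers an oscillation above 1 by
   [1 / (2 * n)]. *)
rewrite -subr_ge0 (_ : _ - _ = (j.+1 - 2 * n)%:R / (2 * n ^ 2)%:R) ?divr_ge0//.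
rewrite /d -subn1 !natrB ?leqW// !natrM -natr1.
by field; rewrite n0.
Qed.

End Averages.
(** * Averages over a compact group *)

Section CompactGroupAverages.
Context (R : realType) (E : tvsType R[i]) (G : topologicalGroupType).
Hypothesis G_compact : compact [set: G].
Implicit Types (U V C : set E) (f : G -> E).

Lemma finite_translates_cover (W : set G) : nbhs 1%g W ->
  exists2 l : seq G, (0 < size l)%N & forall g, exists2 h, h \in l & W (h * g)%g.
Proof.
move=> W1.
(* [F] is the filter of large finite lists: with it, the near-covering form of compactness yields a
   finite cover by translates. *)
pose F := filter_from setT (fun l0 : seq G => [set l : seq G | {subset l0 <= l}]).
have FF : Filter F.
  apply: filter_from_filter; first by exists [::].
  move=> l1 l2 _ _; exists (l1 ++ l2) => // l sub.
  by split=> h hl; apply: sub; rewrite mem_cat hl ?orbT.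
have := (compact_near_coveringP _).1 G_compact (seq G) F
  (fun l g => exists2 h, h \in l & W (h * g)%g) FF.
case=> [g _|l _ /(_ l (fun _ => id)) lW]; last first.
  exists l => [|g]; last exact: lW.
  by have [h] := lW 1%g I; case: (l).
have hc : {for g, continuous (fun x : G => (g^-1 * x)%g)}.
  apply: (@continuous_comp _ (G * G)%type _ (fun x => (g^-1, x)%g)
    (fun z => (z.1 * z.2)%g)); last exact: mulg_continuous.
  by apply: cvg_pair; [exact: cvg_cst|exact: cvg_id].
exists ([set x | W (g^-1 * x)%g], [set l : seq G | (g^-1)%g \in l]).
  split; first by apply: hc; rewrite mulVg.
  by exists [:: (g^-1)%g] => // l; apply; rewrite mem_head.
by move=> [x l] /= [Wx gl]; exists (g^-1)%g.
Qed.

(** Uniform continuity: compactness of [G] removes the dependence on [s] from the continuity of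
    [f (s * w) - f s] at [w = 1]. *)
Lemma translation_uniform f U : continuous f -> nbhs 0 U ->
  exists2 W : set G, nbhs 1%g W & forall s w, W w -> U (f (s * w)%g - f s).
Proof.
move=> fc U0.
have WU : \forall w \near (1%g : G), [set: G] `<=` (fun s => U (f (s * w)%g - f s)).
  apply: ((compact_near_coveringP _).1 G_compact) => s _.
  have dc : continuous (fun z : G * G => f (z.1 * z.2)%g - f z.1).
    move=> z; apply: (@continuous_comp _ (E * E)%type _
      (fun z : G * G => (f (z.1 * z.2)%g, f z.1)) (fun x => x.1 - x.2)); last first.
      exact: sub_continuous.
    apply: cvg_pair.
      by apply: (continuous_comp (@mulg_continuous _ z)); exact: fc.
    by apply: continuous_comp; [exact: cvg_fst|exact: fc].
  by have := dc (s, 1%g) U; rewrite /= mulg1 subrr; exact.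
by exists [set w | forall s, U (f (s * w)%g - f s)] => //; apply: filterS WU => w + s; exact.
Qed.

Lemma oscillation_bounded f U : continuous f -> disk U ->
  exists n : nat, forall g h, scaled U n%:R (f g - f h).
Proof.
move=> fc Ud.
have [n _ nU] : \forall n \near \oo, [set: G] `<=` (fun g => scaled U n%:R (f g)).
  apply: ((compact_near_coveringP _).1 G_compact) => g _.
  have [n nf] := scaled_near (f g) Ud; have {}nf := fc g _ nf.
  exists ([set g | scaled U n.+1%:R (f g)], [set m | n < m]%N); first split=> //=.
    by exists n.+1.
  move=> [h m] /= [Uh nm]; apply: scaled_le Uh => //.
  by rewrite ler_nat.
have {}nU g : scaled U n%:R (f g) by apply: (nU n) => /=.
exists (n + n)%N => g h; rewrite natrD; apply: scaled_add => //.
exact: scaledN.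
Qed.

(** [P] records how the resulting function arises from [f] by averages over left translates. Each
    such average lowers the oscillation by a fixed amount until it fits in [U]. *)
Lemma small_oscillation f U (P : (G -> E) -> Prop) :
  continuous f -> disk U -> P f ->
  (forall l f', (0 < size l)%N -> P f' ->
     P (fun g => average l (fun h => f' (h * g)%g))) ->
  exists f', P f' /\ forall g g', U (f' g - f' g').
Proof.
move=> fc Ud Pf Pavg.
have [W W1 Wf] : exists2 W : set G, nbhs 1%g W &
    forall s w, W w -> scaled U (2^-1 * 2^-1) (f (s * w)%g - f s).
  apply: translation_uniform => //; apply: filterS (nbhs0Z _ Ud.1).
    by move=> _ [x Ux <-]; exists x.
  by rewrite mulf_neq0// invr_neq0// pnatr_eq0.
have [l l0 lW] := finite_translates_cover W1.
set n := size l in l0.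
have nn0 : (2 * n)%:R != 0 :> R[i] by rewrite pnatr_eq0 muln_eq0 -lt0n l0.
(* The bound on [W] survives averaging, since it holds for all [s] and the translations act on the
   left. The number [j] counts the gains of [1 / (2 * n)] still needed to bring the oscillation down
   to 1. *)
have step (j : nat) f' : P f' ->
    (forall s w w', W w -> W w' -> scaled U 2^-1 (f' (s * w)%g - f' (s * w')%g)) ->
    (forall g g', scaled U ((2 * n + j)%:R / (2 * n)%:R) (f' g - f' g')) ->
    exists f', P f' /\ forall g g', U (f' g - f' g').
  elim: j f' => [|j IH] f' Pf' Wf' osc.
    exists f'; split=> // g g'; apply/scaled1.
    by have := osc g g'; rewrite addn0 divff.
  apply: (IH (fun g => average l (fun h => f' (h * g)%g))).
  - exact: Pavg.
  - move=> s w w' Ww Ww'; rewrite average_sub.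
    have Uc := @scaled_convex _ _ U 2^-1 Ud.
    by apply: (convex_average Uc) => // h; rewrite !mulgA; exact: Wf'.
  (* Translates bring both [g] and [g'] into [W], which provides the one close pair that the
     contraction requires. *)
  - move=> g g'; have [h lh Wh] := lW g; have [h' lh' Wh'] := lW g'.
    apply: (average_contraction Ud lh lh') => //.
    + by move=> k k'; rewrite -addnS; exact: osc.
    + by rewrite leq_addr.
    + by have := Wf' 1%g _ _ Wh Wh'; rewrite !mul1g.
have [N Nosc] := oscillation_bounded fc Ud.
(* This [j] allows for oscillation [N + 1], above the actual bound [N]. *)
apply: (step (2 * n * N)%N f) => //.
  move=> s w w' Ww Ww'.
  rewrite (_ : 2^-1 = 2^-1 * 2^-1 + 2^-1 * 2^-1); last by field.
  rewrite -[f (s * w)%g](subrK (f s)) -addrA; apply: scaled_add => //.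
    exact: Wf.
  by rewrite -opprB; apply: scaledN => //; exact: Wf.
move=> g g'; apply: scaled_le (Nosc g g') => //.
rewrite natrD mulrDl divff// [(2 * n * N)%:R]natrM mulrAC divff// mul1r.
by rewrite lerDr.
Qed.

End CompactGroupAverages.

(** * Separate continuity of the multiplication *)

Section LocallyConvexAlgebras.
Context (K : numFieldType) (A : lcAlgType K).

Lemma mulr_left_continuous (a : A) : continuous (fun x => a * x).
Proof.
move=> x; apply: (@continuous_comp _ (A * A)%type _ (fun x => (a, x))
  (fun z => z.1 * z.2)); last exact: alg_mul_continuous.
by apply: cvg_pair; [exact: cvg_cst|exact: cvg_id].
Qed.

Lemma mulr_right_continuous (a : A) : continuous (fun x => x * a).
Proof.
move=> x; apply: (@continuous_comp _ (A * A)%type _ (fun x => (x, a))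
  (fun z => z.1 * z.2)); last exact: alg_mul_continuous.
by apply: cvg_pair; [exact: cvg_id|exact: cvg_cst].
Qed.

End LocallyConvexAlgebras.

(** * The invariant mean *)

Section InvariantMean.
Context (R : realType) (A : lcAlgType R[i]) (G : topologicalGroupType).
Variable alpha : G -> {lrmorphism A -> A}.
Hypothesis G_compact : compact [set: G].
Hypothesis alpha_system : dynamical_system alpha.
Implicit Types (U V : set A) (a b c m x y : A) (l : seq G).

Let alphaM g h a : alpha (g * h)%g a = alpha g (alpha h a).
Proof. exact: ds_morphism alpha_system g h a. Qed.

(** [alpha 1] is idempotent and injective, hence the identity. *)
Let alpha1 a : alpha 1%g a = a.
Proof.
have /bij_inj := ds_bijective alpha_system 1%g; apply.
by rewrite -alphaM mulg1.
Qed.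

Lemma alpha_orbit_continuous a : continuous (fun g => alpha g a).
Proof.
have dc := ds_continuous alpha_system.
move=> g; apply: (@continuous_comp _ (G * A)%type _ (fun g => (g, a))
  (fun z => alpha z.1 z.2)); last exact: dc.
by apply: cvg_pair; [exact: cvg_id|exact: cvg_cst].
Qed.

Definition invariant_disk U := disk U /\ forall g x, U x -> U (alpha g x).

(** The points whose whole orbit lies in [W] form an invariant set; compactness of [G] and joint
    continuity of the action make it a neighbourhood of [0]. *)
Lemma invariant_disk_basis V : nbhs 0 V ->
  exists2 U, invariant_disk U & U `<=` V.
Proof.
move=> /disk_basis[W Wd WV].
exists [set x | forall g, W (alpha g x)]; last first.
  by move=> x /(_ 1%g); rewrite alpha1 => /WV.
split; last by move=> g x /= Wx h; rewrite -alphaM.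
split; last first.
  by move=> x y s t Wx Wy st g; rewrite linearD !linearZ /=; apply: (Wd.2).
have WU : \forall x \near (0 : A), [set: G] `<=` (fun g => W (alpha g x)).
  apply: ((compact_near_coveringP _).1 G_compact) => g _.
  have := ds_continuous alpha_system; move=> /(_ (g, 0) W).
  by rewrite /= raddf0; apply; exact: Wd.1.
by apply: filterS WU => x + g; exact.
Qed.

Lemma invariant_disk_third U : invariant_disk U ->
  exists2 V, invariant_disk V & forall x y z, V x -> V y -> V z -> U (x + y + z).
Proof.
move=> [Ud Ug]; have n3 : 3^-1 != 0 :> R[i] by rewrite invr_neq0// pnatr_eq0.
have i3 : 0 <= 3^-1 :> R[i] by rewrite invr_ge0.
exists (scaled U 3^-1) => [|x y z Vx Vy Vz]; last first.
  apply/scaled1; rewrite (_ : 1 = 3^-1 + 3^-1 + 3^-1 :> R[i]); last by field.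
  by apply: scaled_add; rewrite ?addr_ge0 ?invr_ge0 ?ler0n //; exact: scaled_add.
split; last by move=> g _ [u Uu ->]; exists (alpha g u); [exact: Ug|rewrite linearZ].
split; first by apply: filterS (nbhs0Z n3 Ud.1) => _ [x Ux <-]; exists x.
move=> _ _ s t [u Uu ->] [v Uv ->] st; exists (s *: u + t *: v); first exact: Ud.2.
by rewrite scalerDr !scalerA ![3^-1 * _]mulrC.
Qed.

Lemma invariant_disk_separated x : (forall U, invariant_disk U -> U x) -> x = 0.
Proof.
move=> Ux; apply: (@alg_hausdorff _ A) => B C Bx C0.
exists x; split; first exact: nbhs_singleton Bx.
by have [U Ud] := invariant_disk_basis C0; apply; exact: Ux.
Qed.

Definition orbit_average l x := average l (fun h => alpha h x).

Lemma orbit_averageB l x y :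
  orbit_average l (x - y) = orbit_average l x - orbit_average l y.
Proof. by rewrite /orbit_average average_sub; under eq_fun do rewrite raddfB. Qed.

Lemma orbit_averageD l x y :
  orbit_average l (x + y) = orbit_average l x + orbit_average l y.
Proof.
rewrite /orbit_average /average -scalerDr -big_split; congr (_ *: _).
by apply: eq_bigr => h _; rewrite raddfD.
Qed.

Lemma orbit_average1 x : orbit_average [:: 1%g] x = x.
Proof. by rewrite /orbit_average /average big_seq1 alpha1 invr1 scale1r. Qed.

Lemma average_cst (T : Type) (s : seq T) x : (0 < size s)%N -> average s (fun=> x) = x.
Proof.
move=> s0; rewrite /average big_const_seq count_predT iter_addr_0 -[x *+ _]scaler_nat scalerA.
by rewrite mulVf ?scale1r// pnatr_eq0 -lt0n.
Qed.

Lemma orbit_average_fixed l m : (0 < size l)%N -> fixed_points alpha m ->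
  orbit_average l m = m.
Proof.
by move=> l0 mfix; rewrite /orbit_average; under eq_fun do rewrite mfix; exact: average_cst.
Qed.

Lemma orbit_averageMr l x b : fixed_points alpha b ->
  orbit_average l (x * b) = orbit_average l x * b.
Proof.
move=> bfix; rewrite /orbit_average /average -scalerAl mulr_suml; congr (_ *: _).
by apply: eq_bigr => g _; rewrite rmorphM /= bfix.
Qed.

Lemma orbit_average_average (T : Type) (s : seq T) l (F : T -> A) :
  orbit_average l (average s F) = average s (fun t => orbit_average l (F t)).
Proof.
rewrite /orbit_average /average.
under eq_bigr => h _ do rewrite linearZ linear_sum /=.
by rewrite -!scaler_sumr exchange_big !scalerA mulrC.
Qed.

Lemma orbit_average_comp l l' x : orbit_average l (orbit_average l' x) =
  orbit_average [seq (h * h')%g | h <- l, h' <- l'] x.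
Proof.
rewrite /orbit_average /average size_allpairs natrM invfM -scalerA; congr (_ *: _).
rewrite big_allpairs_dep [RHS]scaler_sumr; apply: eq_bigr => h _.
by rewrite linearZ linear_sum; congr (_ *: _); apply: eq_bigr => h' _; rewrite alphaM.
Qed.

Lemma size_products_gt0 l l' : (0 < size l)%N -> (0 < size l')%N ->
  (0 < size [seq (h * h')%g | h <- l, h' <- l'])%N.
Proof. by move=> l0 l'0; rewrite size_allpairs muln_gt0 l0. Qed.

Lemma disk_average (T : Type) (s : seq T) (F : T -> A) c U : disk U ->
  (0 < size s)%N -> (forall t, U (F t - c)) -> U (average s F - c).
Proof.
move=> Ud s0 UF; rewrite -(average_cst c s0) average_sub.
exact: convex_average (disk_convex Ud) s0 UF.
Qed.

Lemma orbit_average_disk l x U : invariant_disk U -> (0 < size l)%N -> U x ->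
  U (orbit_average l x).
Proof.
move=> [Ud Ug] l0 Ux; apply: convex_average => //; first exact: disk_convex.
by move=> g; exact: Ug.
Qed.

(** The hypothesis covers the whole orbit, so it survives an average inserted on the inside, whose
    terms are again orbit points. *)
Lemma orbit_average_near l l' a c U : invariant_disk U -> (0 < size l')%N ->
  (forall g, U (orbit_average l (alpha g a) - c)) ->
  forall g, U (orbit_average l (orbit_average l' (alpha g a)) - c).
Proof.
move=> [Ud Ug] l'0 la g; rewrite [in X in orbit_average l X]/orbit_average.
rewrite orbit_average_average; apply: disk_average => // h.
by rewrite -alphaM.
Qed.

(** With Haar measure, [m] would be the integral of the orbit map of [a]. Uniformity in [g] is what
    allows averages for different elements to be composed. *)
Definition is_mean a m := fixed_points alpha m /\
  forall U, invariant_disk U -> exists2 l, (0 < size l)%N &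
    forall g, U (orbit_average l (alpha g a) - m).

(** The average for [b] goes inside, that for [a] outside. The outer one leaves the fixed point [n]
    in place and maps the invariant disk into itself. *)
Lemma common_average a m b n U : is_mean a m -> is_mean b n -> invariant_disk U ->
  exists2 l, (0 < size l)%N & forall g,
    U (orbit_average l (alpha g a) - m) /\ U (orbit_average l (alpha g b) - n).
Proof.
move=> [_ am] [nfix bn] Ud; have [l l0 la] := am U Ud; have [l' l'0 lb] := bn U Ud.
exists [seq (h * h')%g | h <- l, h' <- l']; first exact: size_products_gt0.
move=> g; rewrite -!orbit_average_comp; split; first exact: orbit_average_near.
rewrite -[n in _ - n](orbit_average_fixed l0 nfix) -orbit_averageB.
exact: orbit_average_disk.
Qed.

Lemma is_meanD a m b n : is_mean a m -> is_mean b n -> is_mean (a + b) (m + n).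
Proof.
move=> am bn; split.
  by move=> g; rewrite raddfD /= am.1 bn.1.
move=> U /invariant_disk_third[V Vd VU]; have [l l0 lP] := common_average am bn Vd.
exists l => // g; have [la lb] := lP g.
rewrite (_ : _ - _ = (orbit_average l (alpha g a) - m) +
  (orbit_average l (alpha g b) - n) + 0); first by apply: VU => //; exact: disk0 Vd.1.
rewrite addr0 addrACA -opprD; congr (_ - _).
by rewrite raddfD /= orbit_averageD.
Qed.

Lemma is_meanMr a m b : is_mean a m -> fixed_points alpha b -> is_mean (a * b) (m * b).
Proof.
move=> [mfix am] bfix; split; first by move=> g; rewrite rmorphM /= mfix bfix.
move=> U Ud.
have [V Vd VU] : exists2 V, invariant_disk V & V `<=` (fun x => U (x * b)).
  apply: invariant_disk_basis; apply: (@mulr_right_continuous _ _ b 0).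
  by rewrite mul0r; exact: Ud.1.1.
have [l l0 la] := am V Vd; exists l => // g.
rewrite rmorphM /= bfix orbit_averageMr// -mulrBl; exact: VU.
Qed.

Lemma is_mean_unique a m n : is_mean a m -> is_mean a n -> m = n.
Proof.
move=> am an; apply/eqP; rewrite eq_sym -subr_eq0; apply/eqP.
apply: invariant_disk_separated => U /invariant_disk_third[V Vd VU].
have [l l0 /(_ 1%g)[la lb]] := common_average am an Vd.
rewrite (_ : n - m = (orbit_average l (alpha 1%g a) - m) -
  (orbit_average l (alpha 1%g a) - n) + 0); last first.
  by rewrite addr0 opprB [RHS]addrC subrKA.
by apply: VU => //; [exact: diskN Vd.1 _|exact: disk0 Vd.1].
Qed.

Lemma is_mean_fixed m : fixed_points alpha m -> is_mean m m.
Proof.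
move=> mfix; split=> // U Ud; exists [:: 1%g] => // g.
by rewrite mfix orbit_average_fixed// subrr; exact: disk0 Ud.1.
Qed.

(* A left average is nearly constant on the whole orbit and a right average is
   nearly invariant; applying one to the other shows that they are close. *)
Lemma mean_approximation a U : invariant_disk U ->
  exists2 c, forall g, U (alpha g c - c) & exists2 l, (0 < size l)%N &
    forall g, U (orbit_average l (alpha g a) - c).
Proof.
move=> Ud; have [V Vd VU] := invariant_disk_third Ud.
have V0 : V 0 by exact: disk0 Vd.1.
have [_ [[l l0 /funext ->] losc]] : exists f, (exists2 l, (0 < size l)%N &
    forall g, f g = orbit_average l (alpha g a)) /\ forall g g', V (f g - f g').
  apply: (@small_oscillation _ _ _ G_compact (fun g => alpha g a)).
  - exact: alpha_orbit_continuous.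
  - exact: Vd.1.
  - by exists [:: 1%g] => // g; rewrite orbit_average1.
  move=> s f s0 [l l0 fE].
  exists [seq (h * h')%g | h <- l, h' <- s]; first exact: size_products_gt0.
  move=> g; rewrite -orbit_average_comp [X in orbit_average l X]/orbit_average.
  rewrite orbit_average_average; congr average; apply/funext => h.
  by rewrite fE alphaM.
(* Here left translation by [h] becomes a right factor [h^-1], so averaging acts on the vector [a].
   Small oscillation of [alpha g^-1 x] then means that [x] is nearly invariant. *)
have [_ [[x [[r r0 xE] /funext ->]] xosc]] : exists f, (exists x,
    (exists2 r, (0 < size r)%N & x = orbit_average r a) /\
    forall g, f g = alpha g^-1%g x) /\ forall g g', V (f g - f g').
  apply: (@small_oscillation _ _ _ G_compact (fun g => alpha g^-1%g a)).
  - move=> g; apply: (@continuous_comp _ _ _ (fun g : G => g^-1%g) (fun g => alpha g a)).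
      exact: invg_continuous.
    exact: alpha_orbit_continuous.
  - exact: Vd.1.
  - by exists a; split=> //; exists [:: 1%g] => //; rewrite orbit_average1.
  move=> s f s0 [x [[r r0 xE] fE]].
  exists (orbit_average (map (fun h => h^-1)%g s) x); split.
    exists [seq (h * h')%g | h <- map (fun h => h^-1)%g s, h' <- r].
      by apply: size_products_gt0; rewrite // size_map.
    by rewrite -orbit_average_comp xE.
  move=> g; rewrite /orbit_average /average size_map big_map linearZ /=.
  by congr (_ *: _); rewrite linear_sum; apply: eq_bigr => h _; rewrite fE invgM alphaM.
have x_fix g : V (alpha g x - x).
  by have := xosc g^-1%g 1%g; rewrite invgK invg1 alpha1.
exists x => [g|]; first by have := VU _ _ _ (x_fix g) V0 V0; rewrite !addr0.
exists l => // g.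
(* [x] is an average of orbit points of [a], along which the left average is nearly constant. *)
have V1 : V (orbit_average l (alpha g a) - orbit_average l x).
  rewrite -opprB; apply: (diskN Vd.1).
  rewrite xE [X in orbit_average l X]/orbit_average orbit_average_average.
  exact: disk_average Vd.1 r0 _.
have V2 : V (orbit_average l x - x) by apply: disk_average Vd.1 l0 x_fix.
by have := VU _ _ _ V1 V2 V0; rewrite addr0 subrKA.
Qed.

(** The approximate means [B U] generate a filter; its limit [m] inherits invariance and
    approximability from nearby points [c]. *)
Lemma is_mean_exists a : tvs_complete A -> exists m, is_mean a m.
Proof.
move=> A_complete.
pose B U := [set c | (forall g, U (alpha g c - c)) /\ exists2 l, (0 < size l)%N &
    forall g, U (orbit_average l (alpha g a) - c)].
pose F := filter_from invariant_disk B.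
have FF : ProperFilter F.
  apply: filter_from_proper; last first.
    by move=> U Ud; have [c] := mean_approximation a Ud; exists c.
  apply: filter_from_filter.
    by have [U Ud _] := invariant_disk_basis (@filterT _ (nbhs (0 : A)) _); exists U.
  move=> U V Ud Vd; exists (U `&` V).
    split; first exact: diskI Ud.1 Vd.1.
    by move=> g x [/Ud.2 ? /Vd.2 ?].
  by move=> c [fc [l l0 lc]]; split; (split; [move=> g; have [] := fc g|
    exists l => // g; have [] := lc g]).
have [|m Fm] := A_complete F FF.
  move=> W /invariant_disk_basis[U /invariant_disk_third[V Vd VU] UW].
  exists (B V, B V); first by split; exists V.
  (* Both [c] and [c'] are compared with the double average of [a] by [l] outside [l']; for [c']
     this uses its near invariance. *)
  move=> [c c'] [/= [cfix [l l0 lc]] [c'fix [l' l'0 lc']]] /=; apply: UW.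
  have V1 : V (orbit_average l (orbit_average l' (alpha 1%g a)) - c).
    exact: orbit_average_near.
  have V2 : V (orbit_average l (orbit_average l' (alpha 1%g a) - c')).
    exact: orbit_average_disk.
  have V3 : V (orbit_average l c' - c') by apply: disk_average Vd.1 l0 c'fix.
  have := VU _ _ _ (diskN Vd.1 V1) V2 V3.
  by rewrite orbit_averageB opprB !addrA subrK subrK.
have near U : invariant_disk U -> exists2 c, B U c & U (c - m).
  move=> Ud.
  have Fm' : F [set c | U (c - m)].
    apply: Fm; under eq_set do rewrite addrC.
    by apply: (@addr_left_continuous _ A (- m) m); rewrite addNr; exact: Ud.1.1.
  have [c [Bc Uc]] := filter_ex (filterI (ex_intro2 _ _ U Ud (@subset_refl _ (B U))) Fm').
  by exists c.
exists m; split.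
  move=> g; apply/eqP; rewrite -subr_eq0; apply/eqP.
  apply: invariant_disk_separated => U /invariant_disk_third[V Vd VU].
  have [c [cfix _] cm] := near V Vd.
  rewrite (_ : _ - _ = - alpha g (c - m) + (alpha g c - c) + (c - m)).
    by apply: VU => //; apply: diskN => //; [exact: Vd.1|exact: Vd.2].
  by rewrite raddfB opprB /= !addrA subrK subrK.
move=> U /invariant_disk_third[V Vd VU]; have [c [_ [l l0 lc]] cm] := near V Vd.
exists l => // g.
by have := VU _ _ _ (lc g) cm (disk0 Vd.1); rewrite addr0 subrKA.
Qed.

End InvariantMean.
(** * Gelfand-Mazur *)

(** With [D = y d/dy], the three functions are [(1 - y)^-1] and its images under [D] and [D^2].
    Applying [D] to the first identity yields the others, the square [y ^+ 2] contributing a factor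
    2 each time. *)
Lemma geometric_halving (F : fieldType) (y : F) : 2 != 0 :> F -> 1 - y != 0 -> 1 + y != 0 ->
  [/\ (1 - y ^+ 2)^-1 = 2^-1 * ((1 - y)^-1 + (1 + y)^-1),
      2 * (y ^+ 2 / (1 - y ^+ 2) ^+ 2) = 2^-1 * (y / (1 - y) ^+ 2 + - y / (1 + y) ^+ 2) &
      2 ^+ 2 * (y ^+ 2 * (1 + y ^+ 2) / (1 - y ^+ 2) ^+ 3) =
      2^-1 * (y * (1 + y) / (1 - y) ^+ 3 + - y * (1 - y) / (1 + y) ^+ 3)].
Proof.
move=> F2 y1 y2.
have y3 : 1 - y ^+ 2 != 0 by rewrite -[1](expr1n _ 2) subr_sqr mulf_neq0.
by split; field; rewrite F2 y1 y2 ?y3.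
Qed.

(** The first two identities are polynomial in [(1 - y)^-1], so its bounds carry over; the third
    trades the first derivative for the second one and a square. *)
Lemma geometric_identities (F : fieldType) (y : F) : 1 - y != 0 ->
  [/\ y / (1 - y) ^+ 2 = (1 - y)^-1 ^+ 2 - (1 - y)^-1,
      y * (1 + y) / (1 - y) ^+ 3 =
        (2 * (1 - y)^-1 - 1) * ((1 - y)^-1 ^+ 2 - (1 - y)^-1) &
      y / (1 - y) ^+ 2 = y * (1 + y) / (1 - y) ^+ 3 * (2 * (1 - y)^-1 - 1)
        - 2 ^+ 2 * (y / (1 - y) ^+ 2) ^+ 2].
Proof. by move=> y1; split; field; rewrite y1. Qed.

(** First-order Taylor expansion in [s] with its exact quadratic remainder. *)
Lemma geometric_increment (F : fieldType) (y s : F) : 1 - y != 0 ->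
  1 - (1 + s) * y != 0 ->
  (1 - (1 + s) * y)^-1 - (1 - y)^-1 - s * (y / (1 - y) ^+ 2) =
  (s * y) ^+ 2 * (1 - y)^-1 ^+ 2 * (1 - (1 + s) * y)^-1.
Proof. by move=> y1 y2; field; rewrite y1 y2. Qed.

Lemma normc_le_add (R : rcfType) (x y : R) : `|(x +i* y)%C| <= (`|x| + `|y|)%:C%C.
Proof.
rewrite normc_def lecR /=; apply: (@le_trans _ _ (Num.sqrt ((`|x| + `|y|) ^+ 2))).
  rewrite ler_sqrt ?sqr_ge0// sqrrD !real_normK ?num_real// lerD2r lerDl.
  by rewrite mulrn_wge0// mulr_ge0.
by rewrite sqrtr_sqr ger0_norm ?addr_ge0.
Qed.

Lemma normc_ge_parts (R : rcfType) (x y r : R) : `|(x +i* y)%C| <= r%:C%C ->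
  `|x| <= r /\ `|y| <= r.
Proof.
rewrite normc_def lecR /= => xyr; split; apply: le_trans xyr.
  by rewrite -sqrtr_sqr ler_sqrt ?addr_ge0 ?sqr_ge0// lerDl sqr_ge0.
by rewrite -sqrtr_sqr ler_sqrt ?addr_ge0 ?sqr_ge0// lerDr sqr_ge0.
Qed.

Lemma unit_disk (K : numFieldType) (A : ciaType K) :
  exists2 U : set A, disk U & forall u, U u -> (1 - u) \is a GRing.unit.
Proof.
have unit1 : nbhs (1 : A) [set a : A | a \is a GRing.unit].
  by apply: open_nbhs_nbhs; split; [exact: units_open|exact: unitr1].
have := @addr_left_continuous _ A 1 0; rewrite /continuous_at addr0.
move=> /(_ _ unit1) /disk_basis[U Ud Uunit].
by exists U => // u Uu; apply: (Uunit (- u)); exact: diskN.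
Qed.

(** * Boundedness in the residue field and local bounds for resolvents *)

Section BoundedModuloKernel.
Context (R : realType) (A : comCiaType R[i]) (B : fieldType) (p : {rmorphism A -> B}).
Implicit Types (U V : set A) (r s : R) (b c : B) (z : R[i]).

Definition scalar_image : {rmorphism R[i] -> B} := p \o in_alg A.
Local Notation i_ := scalar_image.

(* The residue field carries no topology: sizes are measured on lifts to [A]. *)
Definition bounded_by U r b := exists2 x, scaled U r%:C%C x & b = p x.

Lemma bounded_byD U r s b c : disk U -> 0 <= r -> 0 <= s ->
  bounded_by U r b -> bounded_by U s c -> bounded_by U (r + s) (b + c).
Proof.
move=> Ud r0 s0 [x Ux ->] [y Uy ->]; exists (x + y); last by rewrite rmorphD.
by rewrite rmorphD; apply: scaled_add; rewrite ?ler0c.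
Qed.

Lemma bounded_byN U r b : disk U -> bounded_by U r b -> bounded_by U r (- b).
Proof.
move=> Ud [x Ux ->]; exists (- x); last by rewrite rmorphN.
exact: scaledN.
Qed.

Lemma bounded_by_le U r s b : disk U -> 0 <= r -> r <= s ->
  bounded_by U r b -> bounded_by U s b.
Proof.
move=> Ud r0 rs [x Ux ->]; exists x => //.
by apply: scaled_le Ux; rewrite ?ler0c ?lecR.
Qed.

Lemma bounded_byZ U r s b z : disk U -> `|z| <= s%:C%C ->
  bounded_by U r b -> bounded_by U (s * r) (i_ z * b).
Proof.
move=> Ud zs [x Ux ->]; exists (z *: x).
  by rewrite rmorphM; exact: scaled_scale.
by rewrite /= -rmorphM /= mulr_algl.
Qed.

Lemma bounded_byM U V r s b c : (forall x y, U x -> U y -> V (x * y)) ->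
  bounded_by U r b -> bounded_by U s c -> bounded_by V (r * s) (b * c).
Proof.
move=> UV [_ [u Uu ->] ->] [_ [v Uv ->] ->].
exists ((r * s)%:C%C *: (u * v)); first by exists (u * v) => //; exact: UV.
by rewrite -rmorphM -scalerAl -scalerAr scalerA rmorphM.
Qed.

Definition bounded_family (T : Type) (D : set T) (f : T -> B) :=
  forall U, disk U -> exists2 r, 0 <= r & forall t, D t -> bounded_by U r (f t).

Lemma bounded_family_cst (T : Type) (D : set T) b :
  (forall c, exists x, p x = c) -> bounded_family D (fun=> b).
Proof.
move=> p_surj U Ud; have [x <-] := p_surj b; have [n /nbhs_singleton xn] := scaled_near x Ud.
exists n.+1%:R => // t _; exists x => //.
by rewrite rmorph_nat.
Qed.

Lemma bounded_familyD (T : Type) (D : set T) f g :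
  bounded_family D f -> bounded_family D g -> bounded_family D (f \+ g).
Proof.
move=> fb gb U Ud; have [r r0 fr] := fb U Ud; have [s s0 gs] := gb U Ud.
exists (r + s); first exact: addr_ge0.
by move=> t Dt; apply: bounded_byD => //; [exact: fr|exact: gs].
Qed.

Lemma bounded_familyN (T : Type) (D : set T) f :
  bounded_family D f -> bounded_family D (\- f).
Proof.
move=> fb U Ud; have [r r0 fr] := fb U Ud; exists r => // t Dt.
by apply: bounded_byN => //; exact: fr.
Qed.

Lemma bounded_familyM (T : Type) (D : set T) f g :
  bounded_family D f -> bounded_family D g -> bounded_family D (f \* g).
Proof.
move=> fb gb V Vd.
have [U Ud UV] : exists2 U, disk U & forall x y, U x -> U y -> V (x * y).
  have := @alg_mul_continuous _ A (0, 0) V; rewrite /= mul0r => /(_ Vd.1).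
  move=> [[P Q] /= [P0 Q0] PQ].
  have [U Ud UPQ] := disk_basis (filterI P0 Q0).
  exists U => // x y /UPQ[Px _] /UPQ[_ Qy]; exact: (PQ (x, y)).
have [r r0 fr] := fb U Ud; have [s s0 gs] := gb U Ud.
exists (r * s); first exact: mulr_ge0.
by move=> t Dt; apply: (bounded_byM UV); [exact: fr|exact: gs].
Qed.

Lemma bounded_family_comp (T T' : Type) (D : set T) (D' : set T') f (h : T' -> T) :
  bounded_family D f -> (forall t, D' t -> D (h t)) -> bounded_family D' (f \o h).
Proof.
move=> fb hD U Ud; have [r r0 fr] := fb U Ud; exists r => // t /hD Dt.
exact: fr.
Qed.

Lemma eq_bounded_family (T : Type) (D : set T) f g :
  (forall t, D t -> f t = g t) -> bounded_family D f -> bounded_family D g.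
Proof.
move=> fg fb U Ud; have [r r0 fr] := fb U Ud; exists r => // t Dt.
by rewrite -fg//; exact: fr.
Qed.

(** If [r0] lifts the inverse at [z0], then [r0 * v^-1] with [v = 1 + (z - z0) d r0] lifts the
    inverse at [z]; it stays bounded because inversion is continuous at [1]. *)
Lemma resolvent_bounded_near (b d : A) (z0 : R[i]) U :
  (forall c, exists x, p x = c) -> disk U -> p (b + z0 *: d) != 0 ->
  exists (n : nat) (e : R[i]), 0 < e /\ forall z, `|z - z0| < e ->
    bounded_by U n%:R (p (b + z *: d))^-1.
Proof.
move=> p_surj Ud bd0; have [r0 r0E] := p_surj (p (b + z0 *: d))^-1.
have [n near_r0] := scaled_near (r0 * 1) Ud.
have inv1 : \forall a \near (1 : A),
    a \is a GRing.unit /\ scaled U n.+1%:R (r0 * a^-1).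
  have unit1 : \forall a \near (1 : A), a \is a GRing.unit.
    by apply: open_nbhs_nbhs; split; [exact: units_open|exact: unitr1].
  have := @invr_continuous1 _ A; rewrite invr1.
  move=> /(_ _ (@mulr_left_continuous _ A r0 1 _ near_r0)).
  rewrite /fmap /within /= => invU.
  have invU' : \forall a \near (1 : A),
      a \is a GRing.unit -> scaled U n.+1%:R (r0 * a^-1) by exact: invU.
  by near=> a; split; [near: a|have : a \is a GRing.unit; near: a].
have [e e0 eU] : exists2 e : R[i], 0 < e & forall z, `|z| < e ->
    let v := 1 + z *: (d * r0) in v \is a GRing.unit /\ scaled U n.+1%:R (r0 * v^-1).
  apply: (@small_multiples _ A (fun x =>
    (1 + x) \is a GRing.unit /\ scaled U n.+1%:R (r0 * (1 + x)^-1))).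
  have := @addr_left_continuous _ A 1 0; rewrite /continuous_at addr0.
  by move=> /(_ _ inv1).
exists n.+1, e; split=> // z /eU /=; set v := 1 + _ => -[v_unit Uv].
exists (r0 * v^-1); first by rewrite rmorph_nat.
have vE : p v = p (b + z *: d) * p r0.
  rewrite -rmorphM (_ : (b + z *: d) * r0 = (b + z0 *: d) * r0 - 1 + v).
    rewrite [p (_ + v)]rmorphD [p (_ - 1)]rmorphB [p (_ * r0)]rmorphM r0E rmorph1.
    by rewrite divff// subrr add0r.
  by rewrite /v addrA subrK scalerBl !mulrDl -!scalerAl -addrA subrKC.
rewrite rmorphM rmorphV// vE invfM mulrCA divff ?mulr1//.
by rewrite r0E invr_eq0.
Unshelve. all: by end_near. Qed.

Lemma resolvent_bounded (b d : A) (r : R) :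
  (forall c, exists x, p x = c) -> (forall z, p (b + z *: d) != 0) ->
  bounded_family [set z | `|z| <= r%:C%C] (fun z => (p (b + z *: d))^-1).
Proof.
move=> p_surj bd0 U Ud.
(* The disc is enlarged to a real square, compact as a product of segments. *)
pose K := (`[- r, r] `*` `[- r, r])%classic : set (R * R).
have Kcompact : compact K by apply: compact_setX; exact: segment_compact.
have [n _ nU] : \forall n \near \oo, K `<=` (fun xy =>
    bounded_by U n%:R (p (b + (xy.1 +i* xy.2)%C *: d))^-1).
  apply: ((compact_near_coveringP _).1 Kcompact) => -[x0 y0] _.
  have [n [e [e0 nU]]] := resolvent_bounded_near p_surj Ud (bd0 (x0 +i* y0)%C).
  have /complex_realP[e' eE] : e \is Num.real by exact: gtr0_real.
  move: e0 nU; rewrite {}eE ltcR => e0 nU.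
  have e20 : 0 < e' / 2 by rewrite divr_gt0.
  exists ([set xy | ball x0 (e' / 2) xy.1 /\ ball y0 (e' / 2) xy.2], [set m | n <= m]%N).
    split; last by exists n.
    by exists (ball x0 (e' / 2), ball y0 (e' / 2)) => //; split; exact: nbhsx_ballx.
  move=> [[x y] m] /= [[xx0 yy0] nm]; apply: (@bounded_by_le _ n%:R); rewrite ?ler_nat//.
  apply: nU; apply: le_lt_trans (normc_le_add _ _) _; rewrite ltcR.
  rewrite -!ball_normE /= in xx0 yy0.
  by rewrite [e']splitr ltrD// distrC.
exists n%:R => // -[x y] /= /normc_ge_parts[xr yr].
by apply: (nU n _ (x, y)) => //=; rewrite /K /= !in_itv /= -!ler_norml.
Qed.

End BoundedModuloKernel.

(** * Averages of resolvents over roots of unity *)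

Section CircleAverages.
Context (R : realType) (A : comCiaType R[i]) (B : fieldType) (p : {rmorphism A -> B}).
Local Notation i_ := (scalar_image p).
Implicit Types (z : R[i]) (t s r : R).

Lemma scalar_image_nat (n : nat) : i_ n%:R = n%:R.
Proof. exact: rmorph_nat. Qed.

Lemma two_neq0 : 2 != 0 :> B.
Proof. by rewrite -(scalar_image_nat 2) fmorph_eq0 pnatr_eq0. Qed.

Lemma unit_circle_sqrt z : `|z| = 1 -> exists2 w, `|w| = 1 & z = w ^+ 2.
Proof.
move=> z1; exists (sqrtC z); last by rewrite sqrtCK.
by apply/eqP; rewrite -(@eqrXn2 _ 2)// -normrX sqrtCK z1 expr1n.
Qed.

(** Unrolled, [phi k z] is the mean of [phi 0] over the [2^k]-th roots of [z], and a mean does not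
    exceed a common bound of its terms. *)
Lemma bounded_circle_average (phi : nat -> R[i] -> B) (U : set A) r : disk U -> 0 <= r ->
  (forall k z, `|z| = 1 -> phi k.+1 (z ^+ 2) = 2^-1 * (phi k z + phi k (- z))) ->
  (forall z, `|z| = 1 -> bounded_by p U r (phi 0%N z)) ->
  forall k z, `|z| = 1 -> bounded_by p U r (phi k z).
Proof.
move=> Ud r0 phiS phi0; elim=> [|k IH] // z /unit_circle_sqrt[w w1 ->].
rewrite phiS// -(scalar_image_nat 2) -fmorphV.
rewrite (_ : r = 2^-1 * (r + r)); last by field.
apply: bounded_byZ => //.
  by rewrite normfV normr_nat fmorphV rmorph_nat.
by apply: bounded_byD => //; apply: IH; rewrite ?normrN.
Qed.

Hypothesis p_surj : forall c, exists x, p x = c.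
Variable a : A.
Hypothesis a_not_scalar : forall z, p a != i_ z.

(* [z] runs over the unit circle, so that [term k t z] is [y ^ (2 ^ k)] for some
   [y = w t a] with [|w| = 1]. *)
Let term k t z := i_ (z * t%:C%C ^+ (2 ^ k)) * p a ^+ (2 ^ k).

Let termS k t z : term k.+1 t (z ^+ 2) = term k t z ^+ 2.
Proof. by rewrite /term expnS mulnC !exprM -exprMn rmorphXn -exprMn. Qed.

Let termN k t z : term k t (- z) = - term k t z.
Proof. by rewrite /term mulNr rmorphN mulNr. Qed.

Let term0 t z : term 0 t z = i_ (z * t%:C%C) * p a.
Proof. by rewrite /term expn0 !expr1. Qed.

Let one_sub_scalarM z : 1 - i_ z * p a != 0.
Proof.
apply/eqP => /subr0_eq e; have [z0|z0] := eqVneq z 0.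
  by move: e => /eqP; rewrite z0 rmorph0 mul0r oner_eq0.
have iz0 : i_ z != 0 by rewrite fmorph_eq0.
by have /eqP := a_not_scalar z^-1; apply; apply: (mulfI iz0); rewrite -e fmorphV mulfV.
Qed.

Let one_sub_term k t z : 1 - term k t z != 0.
Proof.
elim: k z => [|k IH] z; first by rewrite term0.
rewrite -(sqrtCK z) termS -[1](expr1n _ 2) subr_sqr mulf_neq0//.
by rewrite -[term k t _]opprK -termN.
Qed.

Let one_add_term k t z : 1 + term k t z != 0.
Proof. by rewrite -[term k t _]opprK -termN. Qed.

(** Formally [q] and [r_] are the first and second derivatives of [e] along [t d/dt]; the powers of
    2 come from the exponent [2^k]. *)
Let e k t z := (1 - term k t z)^-1.
Let q k t z := 2 ^+ k * (term k t z / (1 - term k t z) ^+ 2).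
Let r_ k t z := (2 ^+ k) ^+ 2 * (term k t z * (1 + term k t z) / (1 - term k t z) ^+ 3).

Let eS k t z : e k.+1 t (z ^+ 2) = 2^-1 * (e k t z + e k t (- z)).
Proof.
rewrite /e termS termN opprK.
by have [-> _ _] := geometric_halving two_neq0 (one_sub_term k t z) (one_add_term k t z).
Qed.

Let qS k t z : q k.+1 t (z ^+ 2) = 2^-1 * (q k t z + q k t (- z)).
Proof.
rewrite /q termS termN opprK exprSr -mulrA.
have [_ -> _] := geometric_halving two_neq0 (one_sub_term k t z) (one_add_term k t z).
by rewrite mulrCA mulrDr.
Qed.

Let rS k t z : r_ k.+1 t (z ^+ 2) = 2^-1 * (r_ k t z + r_ k t (- z)).
Proof.
rewrite /r_ termS termN opprK [2 ^+ k.+1]exprSr exprMn -[_ * 2 ^+ 2 * _]mulrA.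
have [_ _ ->] := geometric_halving two_neq0 (one_sub_term k t z) (one_add_term k t z).
by rewrite mulrCA mulrDr.
Qed.

Let inverse_bounded r :
  bounded_family p [set z | `|z| <= r%:C%C] (fun z => (1 - i_ z * p a)^-1).
Proof.
have resE z : 1 - i_ z * p a = p (1 + z *: (- a)).
  by rewrite rmorphD rmorph1 scalerN rmorphN /= -rmorphM mulr_algl.
apply: (@eq_bounded_family _ _ _ p _ _ (fun z => (p (1 + z *: (- a)))^-1)).
  by move=> z _; rewrite resE.
by apply: resolvent_bounded => // z; rewrite -resE.
Qed.

Let cylinder t := [set sz : R * R[i] | [/\ 0 <= sz.1, sz.1 <= t & `|sz.2| = 1]].

Let e0_bounded t : bounded_family p (cylinder t) (fun sz => e 0 sz.1 sz.2).
Proof.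
apply: (@eq_bounded_family _ _ _ p _ _ ((fun z => (1 - i_ z * p a)^-1) \o
  (fun sz : R * R[i] => sz.2 * sz.1%:C%C))).
  by move=> sz _; rewrite /e term0.
apply: bounded_family_comp (inverse_bounded t) _ => -[s z] /= [s0 st z1].
by rewrite normrM z1 mul1r normc_def lecR /= expr0n addr0 sqrtr_sqr ger0_norm.
Qed.

Let uniform (f : nat -> R -> R[i] -> B) t :
  (forall k s z, f k.+1 s (z ^+ 2) = 2^-1 * (f k s z + f k s (- z))) ->
  bounded_family p (cylinder t) (fun sz => f 0 sz.1 sz.2) ->
  bounded_family p [set ksz : nat * (R * R[i]) | cylinder t ksz.2]
    (fun ksz => f ksz.1 ksz.2.1 ksz.2.2).
Proof.
move=> fS f0 U Ud; have [r r0 fr] := f0 U Ud; exists r => // -[k [s z]] /= [s0 st z1].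
apply: (@bounded_circle_average (fun k => f k s)) => // w w1.
by apply: (fr (s, w)).
Qed.

Let e_bounded t := uniform eS (@e0_bounded t).

Let q_bounded t : bounded_family p [set ksz : nat * (R * R[i]) | cylinder t ksz.2]
    (fun ksz => q ksz.1 ksz.2.1 ksz.2.2).
Proof.
apply: uniform qS _; have eb := @e0_bounded t.
apply: eq_bounded_family (bounded_familyD (bounded_familyM eb eb) (bounded_familyN eb)).
move=> -[s z] _ /=; rewrite /q expr0 mul1r.
by have [-> _ _] := geometric_identities (one_sub_term 0 s z).
Qed.

Let r_bounded t : bounded_family p [set ksz : nat * (R * R[i]) | cylinder t ksz.2]
    (fun ksz => r_ ksz.1 ksz.2.1 ksz.2.2).
Proof.
apply: uniform rS _; have eb := @e0_bounded t.
have cb c := @bounded_family_cst _ _ _ p _ (cylinder t) c p_surj.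
have := bounded_familyM (bounded_familyD (bounded_familyM (cb 2) eb) (cb (-1)))
  (bounded_familyD (bounded_familyM eb eb) (bounded_familyN eb)).
apply: eq_bounded_family.
move=> -[s z] _ /=; rewrite /r_ expr0 expr1n mul1r.
by have [_ -> _] := geometric_identities (one_sub_term 0 s z).
Qed.

(* For [y = term k t z], halving alone bounds [y / (1 - y)^2] by [O(2^-k)] and
   [y (1 + y) / (1 - y)^3] by [O(4^-k)]; the third identity of
   [geometric_identities] combines them into an [O(4^-k)] bound for the former. *)
Let q_decay t : bounded_family p [set ksz : nat * (R * R[i]) | cylinder t ksz.2]
    (fun ksz => 2 ^+ ksz.1 * q ksz.1 ksz.2.1 ksz.2.2).
Proof.
have eb := @e_bounded t; have qb := @q_bounded t; have rb := @r_bounded t.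
have cb c := @bounded_family_cst _ _ _ p _
  [set ksz : nat * (R * R[i]) | cylinder t ksz.2] c p_surj.
have := bounded_familyD
  (bounded_familyM rb (bounded_familyD (bounded_familyM (cb 2) eb) (cb (-1))))
  (bounded_familyN (bounded_familyM (cb 4) (bounded_familyM qb qb))).
apply: eq_bounded_family.
move=> -[k [s z]] _ /=; rewrite /q /r_ /e.
have [_ _] := geometric_identities (one_sub_term k s z).
set y := _ / _ ^+ 2; set y' := _ / _ ^+ 3; set y'' := _^-1 => yE.
by rewrite [in RHS]yE; ring.
Qed.

(** Error of the linear approximation of [e]; the step is divided by [s] because [q] is a derivative
    along [t d/dt]. *)
Let increment k s s' z := e k s' z - e k s z - i_ ((s' - s) / s)%:C%C * q k s z.

(** The error is linear in [e] and [q] with coefficients independent of [k], so it obeys the halving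
    rule, and the quadratic bound at [k = 0] holds for all [k]. *)
Let increment_bound t U : disk U -> exists2 n, 0 <= n & forall k s s' z,
  0 < s -> s <= t -> 0 <= s' -> s' <= t -> `|z| = 1 ->
  bounded_by p U ((s' - s) ^+ 2 * n) (increment k s s' z).
Proof.
move=> Ud.
pose D := [set x : (R * R) * R[i] | cylinder t (x.1.1, x.2) /\ cylinder t (x.1.2, x.2)].
have [n n0 nU] : exists2 n, 0 <= n & forall x, D x -> bounded_by p U n
    (p a ^+ 2 * (e 0 x.1.1 x.2 ^+ 2 * e 0 x.1.2 x.2)).
  have eb := bounded_family_comp (@e0_bounded t)
    (h := fun x : (R * R) * R[i] => (x.1.1, x.2)) (D' := D) (fun x Dx => Dx.1).
  have eb' := bounded_family_comp (@e0_bounded t)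
    (h := fun x : (R * R) * R[i] => (x.1.2, x.2)) (D' := D) (fun x Dx => Dx.2).
  have ab := @bounded_family_cst _ _ _ p _ D (p a ^+ 2) p_surj.
  exact: (bounded_familyM ab (bounded_familyM (bounded_familyM eb eb) eb')) U Ud.
exists n => // k s s' z s0 st s'0 s't.
apply: (@bounded_circle_average (fun k => increment k s s')) => //.
- by rewrite mulr_ge0// sqr_ge0.
- move=> {}k {}z z1; rewrite /increment !eS qS; move: (i_ _) 2^-1.
  move: (e k s' z) (e k s' (- z)) (e k s z) (e k s (- z)) (q k s z) (q k s (- z)).
  by move=> *; ring.
move=> {}z z1; have s_neq0 : s%:C%C != 0 by rewrite fmorph_eq0 gt_eqF.
set sg := i_ ((s' - s) / s)%:C%C.
have termE : term 0 s' z = (1 + sg) * term 0 s z.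
  rewrite !term0 mulrA /sg -(rmorph1 i_) -rmorphD -rmorphM; congr (i_ _ * _).
  by rewrite rmorphM rmorphB fmorphV; field.
have sgE : sg * term 0 s z = i_ ((s' - s)%:C%C * z) * p a.
  rewrite term0 mulrA -rmorphM; congr (i_ _ * _).
  by rewrite rmorphM fmorphV; field.
have -> : increment 0 s s' z = i_ (((s' - s)%:C%C * z) ^+ 2) *
    (p a ^+ 2 * (e 0 s z ^+ 2 * e 0 s' z)).
  rewrite /increment /q expr0 mul1r /e termE -/sg geometric_increment//; last first.
    by rewrite -termE.
  by rewrite sgE rmorphXn exprMn !mulrA.
apply: bounded_byZ => //; last first.
  by apply: (nU ((s, s'), z)); split; split=> //; exact: ltW.
rewrite normrX normrM z1 mulr1 normc_def /= expr0n addr0 sqrtr_sqr.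
by rewrite -rmorphXn /= lecR real_normK// num_real.
Qed.

(** The interval is cut into [2^k] steps of length [h = O(2^-k)]. By [increment_bound] and [q_decay]
    each step changes [e] by [O(4^-k)], which sums to [O(2^-k)]. *)
Let path_bound t0 t1 U : 0 < t0 -> t0 <= t1 -> disk U -> exists2 c, 0 <= c &
  forall k, bounded_by p U (c / 2 ^+ k) (e k t1 1 - e k t0 1).
Proof.
move=> t00 t01 Ud; have [n n0 nU] := @increment_bound t1 U Ud.
have [m m0 mU] := @q_decay t1 U Ud.
exists ((t1 - t0) ^+ 2 * n + (t1 - t0) / t0 * m).
  by rewrite addr_ge0 // mulr_ge0 ?sqr_ge0 // divr_ge0 ?subr_ge0 // ltW.
move=> k; have k0 : 0 < 2 ^+ k :> R by rewrite exprn_gt0.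
pose h := (t1 - t0) / 2 ^+ k; pose s (i : nat) := t0 + i%:R * h.
have h0 : 0 <= h by rewrite divr_ge0 ?subr_ge0// ltW.
pose c := h ^+ 2 * n + h / t0 / 2 ^+ k * m.
have hn0 : 0 <= h ^+ 2 * n by rewrite mulr_ge0 ?sqr_ge0.
have hm0 : 0 <= h / t0 / 2 ^+ k * m.
  rewrite mulr_ge0 // mulr_ge0 ?invr_ge0 ?(ltW k0) //.
  by rewrite divr_ge0 // ltW.
have c0 : 0 <= c by rewrite addr_ge0.
have s_ge i : t0 <= s i by rewrite lerDl mulr_ge0.
have s_le i : (i <= 2 ^ k)%N -> s i <= t1.
  move=> ik; rewrite -lerBrDl /h mulrCA -[leRHS]mulr1 ler_wpM2l ?subr_ge0//.
  by rewrite ler_pdivrMr// mul1r -natrX ler_nat.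
have bound i : (i <= 2 ^ k)%N -> bounded_by p U (i%:R * c) (e k (s i) 1 - e k t0 1).
  elim: i => [|i IH] ik.
    rewrite /s !mul0r addr0 subrr; exists 0; last by rewrite rmorph0.
    exact: scaled0.
  have bU := IH (ltnW ik); set b := e k (s i) 1 - e k t0 1 in bU.
  have -> : e k (s i.+1) 1 - e k t0 1 = b + (increment k (s i) (s i.+1) 1 +
      i_ ((s i.+1 - s i) / s i)%:C%C * q k (s i) 1).
    by rewrite /increment subrK /b [RHS]addrC subrKA.
  have sS : s i.+1 - s i = h by rewrite /s -natr1; ring.
  have si0 : 0 < s i by exact: lt_le_trans (s_ge i).
  rewrite -natr1 mulrDl mul1r; apply: bounded_byD; rewrite ?mulr_ge0//.
  apply: bounded_byD => //.
    rewrite -{1}sS; apply: nU; rewrite ?normr1//; first exact/s_le/ltnW.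
      by rewrite ltW// (lt_le_trans t00).
    exact: s_le.
  rewrite sS.
  have -> : i_ (h / s i)%:C%C * q k (s i) 1 =
      i_ (h / s i / 2 ^+ k)%:C%C * (2 ^+ k * q k (s i) 1).
    have k0' : 2 ^+ k != 0 :> B by rewrite expf_neq0// two_neq0.
    have -> : i_ (h / s i / 2 ^+ k)%:C%C = i_ (h / s i)%:C%C / 2 ^+ k.
      rewrite [(_ / 2 ^+ k)%:C%C]rmorphM fmorphV rmorphXn rmorph_nat.
      by rewrite rmorphM fmorphV rmorphXn rmorph_nat.
    by rewrite mulrA divfK.
  apply: bounded_byZ => //.
    rewrite normc_def /= expr0n addr0 sqrtr_sqr lecR ger0_norm.
      apply: ler_wpM2r; first by rewrite invr_ge0 ltW.
      by apply: ler_wpM2l => //; rewrite lef_pV2.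
    by rewrite divr_ge0 ?(ltW k0) // divr_ge0 // ltW.
  apply: (mU (k, (s i, 1))); split; rewrite ?normr1//=; first exact: ltW.
  exact/s_le/ltnW.
have := bound (2 ^ k)%N (leqnn _).
have -> : s (2 ^ k)%N = t1 by rewrite /s /h natrX mulrCA divff ?gt_eqF// mulr1 subrKC.
congr (bounded_by _ _ _ _); rewrite /c /h natrX; field.
by rewrite !gt_eqF.
Qed.

(** [e - 1] obeys the halving rule, so [k = 0] suffices, where it is [t] times a bounded family. *)
Let near_zero U : disk U -> exists2 t, 0 < t <= 1 & forall k,
  bounded_by p U 4^-1 (e k t 1 - 1).
Proof.
move=> Ud.
have ab := @bounded_family_cst _ _ _ p _ [set z : R[i] | `|z| <= (1 : R)%:C%C] (p a) p_surj.
have [n n0 nU] := bounded_familyM ab (@inverse_bounded 1) Ud.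
(* The summand 1 keeps the denominator positive when [n = 0] and gives [t <= 1]; moreover
   [t * n <= 4^-1]. *)
pose t := 4^-1 / (n + 1).
have n1 : 0 < n + 1 by rewrite ltr_wpDl.
have t0 : 0 < t by rewrite divr_gt0// invr_gt0.
have t1 : t <= 1 by rewrite ler_pdivrMr// mul1r; lra.
exists t => [|k]; first by rewrite t0.
have := @bounded_circle_average (fun k z => e k t z - 1) U 4^-1 Ud _ _ _ k 1 (normr1 _).
apply.
- by rewrite invr_ge0.
- by move=> {}k z z1; rewrite eS; field; rewrite two_neq0.
move=> z z1.
have zt : `|z * t%:C%C| <= t%:C%C.
  by rewrite normrM z1 mul1r normc_def /= expr0n addr0 sqrtr_sqr ger0_norm// ltW.
have -> : e 0 t z - 1 = i_ (z * t%:C%C) * (p a * (1 - i_ (z * t%:C%C) * p a)^-1).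
  by rewrite /e -term0 mulrA -term0; field; exact: one_sub_term.
apply: (@bounded_by_le _ _ _ _ _ (t * n)) => //.
- by rewrite mulr_ge0// ltW.
- by rewrite /t mulrAC ler_pdivrMr// ler_wpM2l ?invr_ge0// lerDl.
apply: bounded_byZ => //; apply: nU => /=; apply: le_trans zt _.
by rewrite lecR.
Qed.

(** With [w = (z t)^-1], the inverse at [k = 0] is [- w / (a - w)], whose resolvent is bounded for
    [|w| <= 1], the point [w = 0] included. Hence it is [O(1 / t)]. *)
Let near_infinity U : disk U -> exists2 t, 1 <= t & forall k,
  bounded_by p U 4^-1 (e k t 1).
Proof.
move=> Ud.
have resE z : p (a + z *: (- 1)) = p a - i_ z.
  by rewrite rmorphD scalerN rmorphN.
have [|n n0 nU] := @resolvent_bounded _ _ _ p a (- 1) 1 p_surj _ U Ud.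
  by move=> z; rewrite resE subr_eq0.
pose t := 4 * n + 1.
have t1 : 1 <= t by rewrite lerDr mulr_ge0.
have t0 : 0 < t by exact: lt_le_trans t1.
exists t => // k.
have := @bounded_circle_average (fun k z => e k t z) U 4^-1 Ud _ _ _ k 1 (normr1 _).
apply; [by rewrite invr_ge0|by move=> {}k z z1; exact: eS|].
move=> z z1.
have z0 : z != 0 by rewrite -normr_eq0 z1 oner_eq0.
have t0' : t%:C%C != 0 by rewrite fmorph_eq0 gt_eqF.
pose w := (z * t%:C%C)^-1.
have wt : `|w| = (t^-1)%:C%C.
  rewrite normfV normrM z1 mul1r normc_def /= expr0n addr0 sqrtr_sqr.
  by rewrite ger0_norm ?fmorphV// ltW.
have -> : e 0 t z = i_ (- w) * (p (a + w *: (- 1)))^-1.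
  have iw : i_ w = (i_ (z * t%:C%C))^-1 by rewrite fmorphV.
  have zt0 : i_ (z * t%:C%C) != 0 by rewrite fmorph_eq0 mulf_neq0.
  have := one_sub_term 0 t z; have : p a - i_ w != 0 by rewrite subr_eq0.
  rewrite resE rmorphN /e term0 iw; move: (i_ _) (p a) zt0 => u v u0 h1 h2; field.
  by rewrite u0 h2 -oppr_eq0 opprB [v * u]mulrC h2.
apply: (@bounded_by_le _ _ _ _ _ (t^-1 * n)) => //.
- by rewrite mulr_ge0// invr_ge0 ltW.
- by rewrite mulrC ler_pdivrMr// /t; lra.
apply: bounded_byZ => //; first by rewrite normrN wt.
by apply: nU; rewrite /= wt lecR invf_le1.
Qed.

(** For large [k] the bounds at both ends and along the path lift [1] to some [x] in [U]; then
    [1 - x] is a unit in the kernel of [p]. *)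
Lemma not_scalar_absurd : False.
Proof.
have [U Ud Uunit] := unit_disk A.
have [t0 /andP[t00 t01] e0U] := near_zero Ud.
have [t1 t11 e1U] := near_infinity Ud.
have [c c0 pathU] := path_bound t00 (le_trans t01 t11) Ud.
have [k ck] : exists k : nat, c / 2 ^+ k <= 2^-1.
  exists (Num.truncn (2 * c)); rewrite ler_pdivrMr ?exprn_gt0// ler_pdivlMl//.
  by rewrite ltW// (lt_le_trans (truncnS_gt _))// -natrX ler_nat ltn_expl.
have [x /scaled1 Ux] : bounded_by p U 1 1.
  (* The three terms have sizes 1/4, 1/2 and 1/4. *)
  have -> : 1 = - (e k t0 1 - 1) + (- (e k t1 1 - e k t0 1) + e k t1 1).
    by move: (e k t0 1) (e k t1 1) => u v; ring.
  rewrite (_ : 1 = 4^-1 + (2^-1 + 4^-1) :> R); last by field.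
  apply: bounded_byD; rewrite ?addr_ge0 ?invr_ge0//.
    by apply: bounded_byN.
  apply: bounded_byD; rewrite ?invr_ge0//; apply: bounded_byN => //.
  by apply: bounded_by_le (pathU k); rewrite ?divr_ge0 ?exprn_ge0.
move=> px; have := rmorph_unit p (Uunit _ Ux).
by rewrite rmorphB rmorph1 -px subrr unitr0.
Qed.

End CircleAverages.

Lemma gelfand_mazur (R : realType) (A : comCiaType R[i]) (B : fieldType)
    (p : {rmorphism A -> B}) : (forall c, exists x, p x = c) ->
  forall a, exists z : R[i], p a = scalar_image p z.
Proof.
move=> p_surj a; apply: contrapT => no_scalar.
apply: (@not_scalar_absurd R A B p p_surj a) => z.
by apply/eqP => az; apply: no_scalar; exists z.
Qed.
(** * Characters *)

Section Characters.
Context (K : numFieldType) (B : algType K) (chi : B -> K^o).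
Hypothesis chi_char : character chi.

Lemma character0 : chi 0 = 0.
Proof.
have := character_linear chi_char (-1) 0 0.
by rewrite scaler0 addr0 scaleN1r addNr.
Qed.

Lemma characterD b c : chi (b + c) = chi b + chi c.
Proof. by have := character_linear chi_char 1 b c; rewrite !scale1r. Qed.

Lemma characterZ k b : chi (k *: b) = k * chi b.
Proof. by have := character_linear chi_char k b 0; rewrite !addr0 character0 addr0. Qed.

Lemma characterB b c : chi (b - c) = chi b - chi c.
Proof. by rewrite characterD -scaleN1r characterZ mulN1r. Qed.

Lemma character1 : chi 1 = 1.
Proof.
have [b b0] := character_neq0 chi_char; apply: (mulIf b0).
by rewrite -(character_mul chi_char) !mul1r.
Qed.

(** The map [j] covers both the identity of [A] and the inclusion of the fixed algebra. If
    [|chi b| >= 1] with [j b] in a suitable disk, then [1 - (chi b)^-1 b] is invertible although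
    [chi] vanishes on it. *)
Lemma character_continuous_along (A : ciaType K) (j : B -> A) :
  linear j -> (forall b, (1 - j b) \is a GRing.unit -> exists c, (1 - b) * c = 1) ->
  forall b0 (e : K), 0 < e -> exists2 V, nbhs (j b0) V &
    forall b, V (j b) -> `|chi b0 - chi b| < e.
Proof.
move=> j_linear j_inv.
have [U Ud Uunit] := unit_disk A.
have j0 : j 0 = 0.
  by have := j_linear (-1) 0 0; rewrite scaler0 addr0 scaleN1r addNr.
have jZ k b : j (k *: b) = k *: j b.
  by have := j_linear k b 0; rewrite !addr0 j0 addr0.
have jB b c : j (c - b) = - j b + j c.
  by have := j_linear (-1) b c; rewrite !scaleN1r [- b + c]addrC.
have chi_lt1 b : U (j b) -> `|chi b| < 1.
  move=> Ub.
  have [b0|b0] := eqVneq (chi b) 0; first by rewrite b0 normr0 ltr01.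
  have nb0 : `|chi b| \is Num.real by exact: normr_real.
  have [//|b1] := real_ltP nb0 (real1 _).
  have [|c c1] := j_inv ((chi b)^-1 *: b).
    apply: Uunit; rewrite jZ; apply: diskZ => //.
    by rewrite normfV invf_le1// normr_gt0.
  have : chi 1 = 0.
    rewrite -c1 (character_mul chi_char) characterB characterZ character1.
    by rewrite mulVf// subrr mul0r.
  by rewrite character1 => /eqP; rewrite oner_eq0.
move=> b0 e e0; exists [set x | ( *:%R e @` U) (- j b0 + x)].
  have := @addr_left_continuous _ A (- j b0) (j b0); rewrite /continuous_at addNr.
  by apply; apply: nbhs0Z; [rewrite gt_eqF|exact: Ud.1].
move=> b /= [u Uu uE]; rewrite distrC -characterB.
have -> : b - b0 = e *: (e^-1 *: (b - b0)) by rewrite scalerA divff ?gt_eqF// scale1r.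
rewrite characterZ normrM gtr0_norm// -[ltRHS]mulr1 ltr_pM2l//; apply: chi_lt1.
by rewrite jZ jB -uE scalerA mulVf ?gt_eqF// scale1r.
Qed.

End Characters.

Lemma character_continuous (K : numFieldType) (A : ciaType K) (chi : A -> K^o) :
  character chi -> continuous chi.
Proof.
move=> chi_char a; apply/cvgrPdist_lt => e e0.
have [||V Va Vchi] := character_continuous_along chi_char (j := id) _ _ a e0 => //.
  by move=> b b_unit; exists (1 - b)^-1; rewrite divrr.
exact: filterS Vchi Va.
Qed.

(** * Continuity and extension of characters of the fixed point algebra *)

Section FixedAlgebraCharacters.
Context (R : realType) (A : comCiaType R[i]) (G : topologicalGroupType).
Variables (alpha : G -> {lrmorphism A -> A}) (chi : fixed_algebra alpha -> R[i]^o).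
Hypothesis chi_char : character chi.

Lemma fixed_points_lift a : fixed_points alpha a ->
  exists b : fixed_algebra alpha, val b = a.
Proof. by move=> afix; exists (SigSub (mem_set afix)). Qed.

Lemma fixed_character_continuous : continuous chi.
Proof.
move=> b0 W /nbhs_ballP[e /= e0 eW].
have [||V Vb0 Vchi] := character_continuous_along chi_char (A := A) (j := val) _ _ b0 e0.
- by move=> k b c; rewrite linearP.
- move=> b b_unit.
  (* The inverse taken in [A] is fixed by every [alpha g], so it lies in the fixed algebra. *)
  have [g|c cE] := @fixed_points_lift (1 - val b)^-1.
    rewrite rmorphV// rmorphB rmorph1; congr (1 - _)^-1.
    exact: (set_mem (valP b) g).
  exists c; apply: val_inj; rewrite rmorphM rmorphB !rmorph1.
  by transitivity ((1 - val b) * val c) => //; rewrite cE divrr.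
have val_cont : continuous (val : fixed_algebra alpha -> A) by exact: initial_continuous.
have nbV : nbhs b0 [set b | V (val b)] by exact: val_cont b0 _ Vb0.
have VW : [set b | V (val b)] `<=` [set b | W (chi b)].
  by move=> b /= /Vchi chib; apply: eW; rewrite -ball_normE.
exact: filterS VW nbV.
Qed.

Hypothesis A_complete : tvs_complete A.
Hypothesis G_compact : compact [set: G].
Hypothesis alpha_system : dynamical_system alpha.

(* It contains the ideal generated by the kernel of [chi] and is visibly proper. *)
Let kernel_ideal := [set x | forall a, exists2 m : fixed_algebra alpha,
  is_mean alpha (a * x) (val m) & chi m = 0].

Let kernel_ideal_proper : proper_ideal_set kernel_ideal.
Proof.
split=> [x y Ix Iy a|b x Ix a|/(_ 1)[m]].
- have [m mx m0] := Ix a; have [n ny n0] := Iy a; exists (m + n).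
    by rewrite mulrDr rmorphD; exact: is_meanD.
  by rewrite characterD// m0 n0 addr0.
- by have [m] := Ix (a * b); rewrite -mulrA; exists m.
rewrite mulr1 => m1.
have -> : m = 1.
  apply: val_inj; apply: (is_mean_unique G_compact alpha_system m1).
  by apply: is_mean_fixed => // g; rewrite rmorph1.
by rewrite character1// => /eqP; rewrite oner_eq0.
Qed.

Let kernel_sub (b : fixed_algebra alpha) : chi b = 0 -> kernel_ideal (val b).
Proof.
move=> b0 a; have [m0 am] := is_mean_exists G_compact alpha_system a A_complete.
have [m mE] := fixed_points_lift am.1.
exists (m * b); last by rewrite (character_mul chi_char) b0 mulr0.
have -> : val (m * b) = m0 * val b by rewrite -mE; exact: rmorphM.
by apply: is_meanMr => //; exact: set_mem (valP b).
Qed.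

Lemma fixed_character_extension : exists chi' : A -> R[i]^o,
  character chi' /\ forall b : fixed_algebra alpha, chi' (val b) = chi b.
Proof.
have I0 : kernel_ideal 0.
  have <- : val (0 : fixed_algebra alpha) = 0 by exact: rmorph0.
  by apply: kernel_sub; exact: character0.
have [F [p [p_surj pI]]] := residue_field kernel_ideal_proper I0.
have [chi' chi'E] := choice (gelfand_mazur p_surj).
have inj := fmorph_inj (scalar_image p).
exists chi'; split=> [|b].
  split=> [k a b|a b|].
  - apply: inj; rewrite -chi'E rmorphD -mulr_algl rmorphM (chi'E a) (chi'E b).
    by rewrite [RHS]rmorphD [X in _ = X + _]rmorphM.
  - by apply: inj; rewrite -chi'E !rmorphM -!chi'E.
  - exists 1; suff -> : chi' 1 = 1 by rewrite oner_eq0.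
    by apply: inj; rewrite -chi'E !rmorph1.
apply: inj; rewrite -chi'E.
(* Subtracting the scalar [chi b] lands in the kernel of [chi], which [p] kills; so [p] sends
   [val b] to the image of that scalar. *)
have /kernel_sub/pI : chi (b - chi b *: 1) = 0.
  by rewrite characterB// characterZ// character1// mulr1 subrr.
by rewrite !rmorphB linearZ rmorph1 => /subr0_eq.
Qed.

End FixedAlgebraCharacters.

Theorem theorem2p5 (R : realType) (A : comCiaType R[i])
    (G : topologicalGroupType) (alpha : G -> {lrmorphism A -> A})
    (A_complete : tvs_complete A)
    (G_compact : compact [set: G]) (G_hausdorff : hausdorff_space G)
    (alpha_system : dynamical_system alpha)
    (chi : fixed_algebra alpha -> R[i]^o) (chi_char : character chi) :
  continuous chi /\
  exists chi' : A -> R[i]^o,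
    [/\ character chi', continuous chi'
      & forall a : fixed_algebra alpha, chi' (val a) = chi a].
Proof.
split; first exact: fixed_character_continuous.
have [chi' [chi'_char chi'E]] :=
  fixed_character_extension chi_char A_complete G_compact alpha_system.
by exists chi'; split=> //; exact: character_continuous.
Qed.
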